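(* Let $k\geq1$ and let $\mathcal{G}^{(k)}$ be a memory-$k$ stochastic temporal graph whose underlying graph $G$ has $n$ vertices and $m$ edges. Then Best Policy can be solved exactly on $\mathcal{G}^{(k)}$ in $O\big(2^{(kmn+n\log n)\cdot 2^{km}}\big)$ time.
   Context: For $k\geq1$, a memory-$k$ stochastic temporal graph on $G=(V,E)$ is specified by initial snapshots $G_{-k+1},\ldots,G_0\subseteq G$ and, for every edge $e$ and every $h\in\{0,1\}^k$, a probability $p_e(h)$; for each $t\geq1$, with $H_e^{(k)}\in\{0,1\}^k$ recording presence/absence of $e$ in $G_{t-k},\ldots,G_{t-1}$, edge $e$ belongs to $G_t$ with probability $p_e(H_e^{(k)})$, independently of other edges. Best Policy: Alice starts at vertex $s$ at time $0$. At each step $t\geq 0$, once snapshot $G_{t+1}$ is revealed, knowing her current position, the last $k$ snapshots, and the model parameters, she either stays at her current vertex or moves to a neighbour of it in $G_{t+1}$. The arrival time is the first time she is at $y$. Best Policy asks, for distinct $s,y$, for the minimum over all policies of the expected arrival time. *)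

(* Defs.v *)
From HB Require Import structures.
From mathcomp Require Import all_boot all_order all_algebra.
From mathcomp Require Import all_classical all_reals all_analysis.

Set Implicit Arguments.
Unset Strict Implicit.
Unset Printing Implicit Defensive.

Import Order.TTheory GRing.Theory Num.Theory.
Local Open Scope classical_set_scope.
Local Open Scope ring_scope.

(* A finite simple graph on 'I_n whose m edges are numbered; the edge {u, v}
   is given by its endpoints in increasing order. *)
Record graph (n m : nat) := Graph {
  ends : 'I_m -> 'I_n * 'I_n;
  ends_lt : forall e, ((ends e).1 < (ends e).2)%N;
  ends_inj : injective ends }.

(* A snapshot is a spanning subgraph of G, identified with its edge set. *)
Notation snapshot m := {set 'I_m}.

(* k consecutive snapshots, oldest first. *)
Notation window k m := (k.-tuple (snapshot m)).

Definition adjacent n m (G : graph n m) (A : snapshot m) (u v : 'I_n) : bool :=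
  [exists e in A, (ends G e == (u, v)) || (ends G e == (v, u))].

Record stgraph (R : realType) (k n m : nat) := STGraph {
  underlying : graph n m;
  init : window k m;
  prob : 'I_m -> k.-tuple bool -> R;
  prob01 : forall e h, 0 <= prob e h <= 1 }.

(* For an evolution x, the snapshot at time t >= 1 is x t; x 0 is never used.
   Entry j of the timeline is the snapshot at time j - k + 1. *)
Definition timeline k m (w0 : window k m) (x : nat -> snapshot m) (j : nat) :
    snapshot m :=
  if (j < k)%N then nth finset.set0 w0 j else x (j - k).+1.

(* The snapshots at times t - k + 1, ..., t. *)
Definition window_at k m (w0 : window k m) (x : nat -> snapshot m) (t : nat) :
    window k m :=
  [tuple timeline w0 x (t + i) | i < k].

Definition edge_history k m (W : window k m) (e : 'I_m) : k.-tuple bool :=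
  [tuple e \in tnth W i | i < k].

(* Probability that the next snapshot is A when the last k ones are W. *)
Definition step_prob (R : realType) k n m (M : stgraph R k n m)
    (W : window k m) (A : snapshot m) : R :=
  \prod_(e < m) (if e \in A then prob M e (edge_history W e)
                 else 1 - prob M e (edge_history W e)).

(* X t is the random snapshot at time t >= 1.  The conditional law of the next
   snapshot given the past is stated with the denominator cleared, so that
   pasts of probability 0 are harmless. *)
Definition is_evolution (R : realType) k n m (M : stgraph R k n m)
    (d : measure_display) (Omega : measurableType d) (P : probability Omega R)
    (X : nat -> Omega -> snapshot m) : Prop :=
  (forall t A, (0 < t)%N -> measurable [set w | X t w = A]) /\
  (forall (t : nat) (g : nat -> snapshot m),
     P [set w | forall i, (0 < i <= t.+1)%N -> X i w = g i] =
     (P [set w | forall i, (0 < i <= t)%N -> X i w = g i] *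
      (step_prob M (window_at (init M) g t) (g t.+1))%:E)%E).

(* pi t W v is Alice's choice at step t, when she is at v and W consists of
   the last k snapshots, the newest being the just revealed one of time t+1. *)
Definition policy (k n m : nat) := nat -> window k m -> 'I_n -> 'I_n.

Definition legal (R : realType) k n m (M : stgraph R k n m)
    (pi : policy k n m) : Prop :=
  forall t W v,
    pi t W v = v \/ adjacent (underlying M) (last finset.set0 W) v (pi t W v).

Fixpoint position k n m (w0 : window k m) (x : nat -> snapshot m)
    (pi : policy k n m) (s : 'I_n) (t : nat) : 'I_n :=
  if t is t'.+1 then pi t' (window_at w0 x t) (position w0 x pi s t') else s.

(* +oo when y is never reached *)
Definition arrival (R : realType) k n m (w0 : window k m)
    (x : nat -> snapshot m) (pi : policy k n m) (s y : 'I_n) : \bar R :=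
  ereal_inf [set (t%:R)%:E | t in [set t | position w0 x pi s t = y]].

Definition expected_arrival (R : realType) k n m (M : stgraph R k n m)
    (d : measure_display) (Omega : measurableType d) (P : probability Omega R)
    (X : nat -> Omega -> snapshot m) (pi : policy k n m) (s y : 'I_n) :
    \bar R :=
  (\int[P]_w arrival R (init M) (X ^~ w) pi s y)%E.

Definition is_best (R : realType) k n m (M : stgraph R k n m)
    (d : measure_display) (Omega : measurableType d) (P : probability Omega R)
    (X : nat -> Omega -> snapshot m) (s y : 'I_n) (v : \bar R) : Prop :=
  (exists2 pi, legal M pi & expected_arrival M P X pi s y = v) /\
  (forall pi, legal M pi -> (v <= expected_arrival M P X pi s y)%E).

(* A real RAM.
    Programs are structured; the memory consists of arrays of naturals and
    arrays of reals, with indirect addressing and array names fixed in the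
    program text.  Reals support exact field operations and comparisons, with
    only 0 and 1 as constants and no rounding; naturals support addition,
    truncated subtraction, halving and comparison, but no multiplication, so
    that unit cost does not give access to huge numbers. *)

Inductive nexp : Type :=
| NConst of nat
| NGet of nat & nexp
| NAdd of nexp & nexp
| NSub of nexp & nexp
| NHalf of nexp.

Inductive rexp : Type :=
| RZero
| ROne
| RGet of nat & nexp
| RAdd of rexp & rexp
| RSub of rexp & rexp
| RMul of rexp & rexp
| RDiv of rexp & rexp.

Inductive test : Type :=
| NLe of nexp & nexp
| RLe of rexp & rexp.

(* NSet a i e and RSet a i e store e in cell i of array a. *)
Inductive cmd : Type :=
| Skip
| NSet of nat & nexp & nexp
| RSet of nat & nexp & rexp
| Seq of cmd & cmd
| If of test & cmd & cmd
| While of test & cmd.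

Record memory (R : realType) := Memory {
  nmem : nat -> nat -> nat;
  rmem : nat -> nat -> R }.

Fixpoint neval (R : realType) (sg : memory R) (e : nexp) : nat :=
  match e with
  | NConst c => c
  | NGet a i => nmem sg a (neval sg i)
  | NAdd e1 e2 => (neval sg e1 + neval sg e2)%N
  | NSub e1 e2 => (neval sg e1 - neval sg e2)%N
  | NHalf e1 => (neval sg e1)./2
  end.

Fixpoint reval (R : realType) (sg : memory R) (e : rexp) : R :=
  match e with
  | RZero => 0
  | ROne => 1
  | RGet a i => rmem sg a (neval sg i)
  | RAdd e1 e2 => reval sg e1 + reval sg e2
  | RSub e1 e2 => reval sg e1 - reval sg e2
  | RMul e1 e2 => reval sg e1 * reval sg e2
  | RDiv e1 e2 => reval sg e1 / reval sg e2
  end.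

Definition teval (R : realType) (sg : memory R) (b : test) : bool :=
  match b with
  | NLe e1 e2 => (neval sg e1 <= neval sg e2)%N
  | RLe e1 e2 => reval sg e1 <= reval sg e2
  end.

Fixpoint ncost (e : nexp) : nat :=
  match e with
  | NConst _ => 1
  | NGet _ i => (ncost i).+1
  | NAdd e1 e2 | NSub e1 e2 => (ncost e1 + ncost e2).+1
  | NHalf e1 => (ncost e1).+1
  end.

Fixpoint rcost (e : rexp) : nat :=
  match e with
  | RZero | ROne => 1
  | RGet _ i => (ncost i).+1
  | RAdd e1 e2 | RSub e1 e2 | RMul e1 e2 | RDiv e1 e2 =>
      (rcost e1 + rcost e2).+1
  end.

Definition tcost (b : test) : nat :=
  match b with
  | NLe e1 e2 => (ncost e1 + ncost e2).+1
  | RLe e1 e2 => (rcost e1 + rcost e2).+1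
  end.

Definition update (T : Type) (f : nat -> nat -> T) (a i : nat) (x : T) :
    nat -> nat -> T :=
  fun b j => if (b == a) && (j == i) then x else f b j.

(* exec c sg t sg': started in memory sg, the program c halts in memory sg'
   after t elementary operations. *)
Inductive exec (R : realType) : cmd -> memory R -> nat -> memory R -> Prop :=
| ExecSkip sg : exec Skip sg 1 sg
| ExecNSet a i e sg :
    exec (NSet a i e) sg (ncost i + ncost e).+1
      (Memory (update (nmem sg) a (neval sg i) (neval sg e)) (rmem sg))
| ExecRSet a i e sg :
    exec (RSet a i e) sg (ncost i + rcost e).+1
      (Memory (nmem sg) (update (rmem sg) a (neval sg i) (reval sg e)))
| ExecSeq c1 c2 sg sg1 sg2 t1 t2 :
    exec c1 sg t1 sg1 -> exec c2 sg1 t2 sg2 ->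
    exec (Seq c1 c2) sg (t1 + t2) sg2
| ExecIfTrue b c1 c2 sg sg1 t1 :
    teval sg b -> exec c1 sg t1 sg1 ->
    exec (If b c1 c2) sg (tcost b + t1) sg1
| ExecIfFalse b c1 c2 sg sg2 t2 :
    ~~ teval sg b -> exec c2 sg t2 sg2 ->
    exec (If b c1 c2) sg (tcost b + t2) sg2
| ExecWhileFalse b c sg :
    ~~ teval sg b -> exec (While b c) sg (tcost b) sg
| ExecWhileTrue b c sg sg1 sg2 t1 t2 :
    teval sg b -> exec c sg t1 sg1 -> exec (While b c) sg1 t2 sg2 ->
    exec (While b c) sg (tcost b + t1 + t2) sg2.

(* Natural arrays: 0 holds the parameters, 1 and 2 the endpoints of the edges,
   and 3 the initial snapshots (bit i * m + e tells whether edge e is in the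
   i-th oldest one).  Real array 0 holds p_e(h) at index
   e * 2^k + \sum_(i < k) h_i * 2^i.  All other cells are 0. *)
Definition input (R : realType) k n m (M : stgraph R k n m) (s y : 'I_n) :
    memory R :=
  Memory
    (fun a i => match a with
     | 0 => nth 0 [:: n; m; k; val s; val y] i
     | 1 => nth 0 [seq val (ends (underlying M) e).1 | e <- enum 'I_m] i
     | 2 => nth 0 [seq val (ends (underlying M) e).2 | e <- enum 'I_m] i
     | 3 => nth 0 [seq nat_of_bool (e \in A) | A : snapshot m <- init M,
                                              e : 'I_m <- enum 'I_m] i
     | _ => 0
     end%N)
    (fun a j =>
     if (a == 0)%N then
       if insub (j %/ 2 ^ k)%N is Some e
       then prob M e [tuple odd (j %/ 2 ^ i) | i < k] else 0
     else 0).

(* Cell 0 of natural array 0 tells whether the answer is finite, in which case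
   the answer is in cell 0 of real array 0. *)
Definition output (R : realType) (sg : memory R) : \bar R :=
  if nmem sg 0%N 0%N == 0%N then +oo%E else (rmem sg 0%N 0%N)%:E.

Definition log2 (R : realType) (x : R) : R := ln x / ln 2.

(* Main.v *)
Require Import Defs.
From mathcomp Require Import all_boot all_order all_algebra.
From mathcomp Require Import all_classical all_reals all_analysis.
From mathcomp Require Import measurable_realfun zify ring lra.

Set Implicit Arguments.
Unset Strict Implicit.
Unset Printing Implicit Defensive.

Import Order.TTheory GRing.Theory Num.Theory numFieldNormedType.Exports.

(** Let [V_T(W, v)] be the least expected value of min(arrival time, T) when
    the last [k] snapshots are [W] and Alice is at [v]; value iteration
    computes it, and [V = sup_T V_T] (possibly infinite) is a lower bound for
    every policy.  By the pigeonhole principle one stationary choice [u] is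
    greedy for infinitely many [T]; then [V >= 1 + Q_u V] where [V] is finite,
    so [u] attains [V].

    There are [N = n * 2^(km)] states and at most [n^N] stationary policies.
    The program enumerates all of them, solves [x = 1 + Q_u x] by Gauss-Jordan
    elimination, and keeps the smallest finite value found at the initial
    state.  For every policy each [V_T] is a sub-solution of the system, a
    property that survives the row operations, so no computed value is below
    [V]; for the optimal policy [V] is a super-solution, hence its computed
    value is at most [V].  The polynomial factor in [N] is absorbed by
    [2^(kmN)] as soon as there is an edge. *)

(** * Value iteration and the expected arrival time *)
Local Open Scope ring_scope.

(** Two obstacles shape the argument. A policy may never reach [y] from some states; its system is
    then singular. Hence nothing is said about solutions or inverses: only inequalities that survive
    row operations on non-negative matrices with positive constants are tracked. The value computed
    for a bad policy is never interpreted; it only has to stay above [V], and one single policy has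
    to bring the minimum down to [V]. Moreover [V] may be infinite at some states although it is
    finite at the initial one. Finiteness passes to every successor of positive probability other
    than [y], since a non-negative term of a bounded sum is bounded. So the rows of finite states
    have no coefficient at infinite ones, and elimination keeps the two kinds apart. On the
    probabilistic side the expectation is a series of tail probabilities, each a finite sum over
    snapshots obtained from events that fix finitely many snapshots. Time-dependent policies are
    then compared with value iteration by induction on the horizon. *)

Definition push k m (W : window k m) (A : snapshot m) : window k m :=
  [tuple nth finset.set0 (rcons W A) i.+1 | i < k].

Lemma last_push k m (W : window k m) (A : snapshot m) :
  (0 < k)%N -> last finset.set0 (push W A) = A.
Proof.
move=> k0; have k1 : (k.-1 < k)%N by lia.
rewrite -nth_last size_tuple -[k.-1]/(val (Ordinal k1)) -tnth_nth tnth_mktuple /=.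
by rewrite prednK // nth_rcons size_tuple ltnn eqxx.
Qed.

Lemma window_at0 k m (w0 : window k m) (x : nat -> snapshot m) :
  window_at w0 x 0 = w0.
Proof.
apply: eq_from_tnth => i; rewrite tnth_mktuple add0n /timeline ltn_ord.
by rewrite -tnth_nth.
Qed.

Lemma window_atS k m (w0 : window k m) (x : nat -> snapshot m) t :
  window_at w0 x t.+1 = push (window_at w0 x t) (x t.+1).
Proof.
apply: eq_from_tnth => i; rewrite !tnth_mktuple nth_rcons size_tuple.
have [ik|] := ltnP i.+1 k.
  rewrite -[i.+1]/(val (Ordinal ik)) -tnth_nth tnth_mktuple /=.
  by rewrite addSnnS.
move=> ki; have iE : i.+1 = k by have := ltn_ord i; lia.
rewrite iE eqxx /timeline addSnnS iE; case: ifP; first by lia.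
by rewrite addnK.
Qed.

Lemma window_at_ext k m (w0 : window k m) (x x' : nat -> snapshot m) t :
  (forall i, (0 < i <= t)%N -> x i = x' i) ->
  window_at w0 x t = window_at w0 x' t.
Proof.
elim: t => [|t IH] H; first by rewrite !window_at0.
rewrite !window_atS IH => [|i /andP[i0 it]]; last by apply: H; rewrite i0 leqW.
by rewrite H // ltnS leqnn.
Qed.

Lemma position_ext k n m (w0 : window k m) (x x' : nat -> snapshot m)
    (pi : policy k n m) s t :
  (forall i, (0 < i <= t)%N -> x i = x' i) ->
  position w0 x pi s t = position w0 x' pi s t.
Proof.
elim: t => [//|t IH] H /=.
by rewrite (window_at_ext w0 H) IH // => i /andP[i0 it]; apply: H; rewrite i0 leqW.
Qed.

Lemma cvg_sum_seq (R : realType) (I : Type) (r : seq I) (F : I -> nat -> R)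
    (l : I -> R) :
  (forall i, F i T @[T --> \oo] --> l i)%classic ->
  (\sum_(i <- r) F i T @[T --> \oo] --> \sum_(i <- r) l i)%classic.
Proof.
move=> H; elim: r => [|i r IH].
  by under eq_fun do rewrite big_nil; rewrite big_nil; exact: cvg_cst.
by under eq_fun do rewrite big_cons; rewrite big_cons; exact: cvgD.
Qed.

Section ValueIteration.
Variables (R : realType) (k n m : nat) (M : stgraph R k n m) (y : 'I_n).
Hypothesis k_gt0 : (0 < k)%N.
Implicit Types (W : window k m) (A : snapshot m) (v : 'I_n).
Implicit Types (f : window k m -> 'I_n -> R).
Implicit Types (u : window k m -> 'I_n -> 'I_n).

Definition stopped f W v : R := if v == y then 0 else f W v.

Definition move_ok A v v' : bool := (v' == v) || Defs.adjacent (underlying M) A v v'.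

(** The Bellman operator of the choice [u]. The snapshot is revealed before Alice moves, so [u]
    reads the window that already contains it. *)
Definition backup u f W v : R :=
  1 + \sum_A step_prob M W A * stopped f (push W A) (u (push W A) v).

Definition allowed u := forall W v, move_ok (last finset.set0 W) v (u W v).

Definition greedy f W v : 'I_n :=
  [arg min_(v' < v | move_ok (last finset.set0 W) v v') stopped f W v']%O.

(* [stopped] masks the junk value at [v = y]: it is the cost of a return to
   [y], which is never read. *)
Fixpoint value T W v : R :=
  if T is T'.+1 then backup (greedy (value T')) (value T') W v else 0.

Lemma step_prob_ge0 W A : 0 <= step_prob M W A.
Proof.
apply: prodr_ge0 => e _; have /andP[p0 p1] := prob01 M e (edge_history W e).
by case: ifP => _ //; rewrite subr_ge0.
Qed.

Lemma move_ok_refl A v : move_ok A v v.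
Proof. by rewrite /move_ok eqxx. Qed.

Lemma greedy_allowed f : allowed (greedy f).
Proof. by move=> W v; rewrite /greedy; case: arg_minP => //; exact: move_ok_refl. Qed.

Lemma greedy_min f W v v' : move_ok (last finset.set0 W) v v' ->
  stopped f W (greedy f W v) <= stopped f W v'.
Proof.
move=> h; rewrite /greedy; case: arg_minP => [|i _]; first exact: move_ok_refl.
exact.
Qed.

Lemma le_stopped f f' W v : (forall W v, f W v <= f' W v) ->
  stopped f W v <= stopped f' W v.
Proof. by move=> H; rewrite /stopped; case: ifP. Qed.

Lemma le_backup u f f' W v : (forall W v, f W v <= f' W v) ->
  backup u f W v <= backup u f' W v.
Proof.
move=> H; rewrite lerD2l ler_sum // => A _.
by rewrite ler_wpM2l ?step_prob_ge0 // le_stopped.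
Qed.

(** At a fixed state the competitor [b] is any function of the snapshot. This is the form needed for
    the program, whose choices are read from an array and corrected when illegal. *)
Lemma backup_greedy_choice f W v (b : snapshot m -> 'I_n) :
  (forall A, move_ok A v (b A)) ->
  backup (greedy f) f W v <=
  1 + \sum_A step_prob M W A * stopped f (push W A) (b A).
Proof.
move=> H; rewrite lerD2l ler_sum // => A _.
rewrite ler_wpM2l ?step_prob_ge0 // greedy_min // last_push //.
Qed.

Lemma backup_greedy u f W v : allowed u ->
  backup (greedy f) f W v <= backup u f W v.
Proof.
move=> H; apply: backup_greedy_choice => A.
by have := H (push W A) v; rewrite last_push.
Qed.

Lemma value_ge0 T W v : 0 <= value T W v.
Proof.
elim: T W v => [//|T IH] W v /=; rewrite addr_ge0 // sumr_ge0 // => A _.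
by rewrite mulr_ge0 ?step_prob_ge0 // /stopped; case: ifP.
Qed.

(** The best choice for the longer horizon is also available for the shorter one, where by induction
    it costs no more. *)
Lemma value_le_succ T W v : value T W v <= value T.+1 W v.
Proof.
elim: T W v => [|T IH] W v; first exact: value_ge0.
apply: (@le_trans _ _ (backup (greedy (value T.+1)) (value T) W v)).
  exact/backup_greedy/greedy_allowed.
exact: le_backup.
Qed.

Lemma value_mono T T' W v : (T <= T')%N -> value T W v <= value T' W v.
Proof.
move=> /subnK <-; elim: (T' - T)%N => [//|d IH].
exact: le_trans IH (value_le_succ _ _ _).
Qed.

Lemma value_sub_choice T W v (b : snapshot m -> 'I_n) :
  (forall A, move_ok A v (b A)) ->
  value T W v <= 1 + \sum_A step_prob M W A * stopped (value T) (push W A) (b A).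
Proof.
by move=> H; apply: le_trans (value_le_succ T W v) (backup_greedy_choice _ _ H).
Qed.

(* Pigeonhole: some stationary greedy choice is made at infinitely many horizons. *)
Lemma recurrent_greedy : exists2 u, allowed u &
  forall T0, exists2 T, (T0 <= T)%N &
    forall W v, value T.+1 W v = backup u (value T) W v.
Proof.
pose g T : {ffun window k m * 'I_n -> 'I_n} :=
  [ffun z => greedy (value T) z.1 z.2].
have [[G HG]|H] := pselect (exists G, forall T0, exists2 T, (T0 <= T)%N & g T = G).
  exists (fun W v => G (W, v)).
    have [T _ <-] := HG 0%N; move=> W v; rewrite ffunE; exact: greedy_allowed.
  move=> T0; have [T h <-] := HG T0; exists T => // W v.
  by rewrite /= /backup; congr (1 + _); apply: eq_bigr => A _; rewrite ffunE.
have H' (G : {ffun window k m * 'I_n -> 'I_n}) :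
    exists T0, forall T, (T0 <= T)%N -> g T <> G.
  have [//|H1] := pselect (exists T0, forall T, (T0 <= T)%N -> g T <> G).
  exfalso; apply: H; exists G => T0; have [//|H2] := pselect (exists2 T, (T0 <= T)%N & g T = G).
  by exfalso; apply: H1; exists T0 => T h1 h2; apply: H2; exists T.
have [F HF] := choice H'.
(* [F G] is a time from which [G] no longer occurs; at the maximum of these times no choice function
   would be left. *)
pose T := (\max_G F G)%N.
by case: (HF (g T) T) => //; exact: leq_bigmax.
Qed.

Definition bounded_value W v := exists b, forall T, value T W v <= b.
(** On an unbounded set [sup] is a default value, hence the boundedness hypotheses below. *)
Definition limit_value W v : R := sup (range (fun T => value T W v)).

Lemma limit_value_ge W v T : bounded_value W v -> value T W v <= limit_value W v.
Proof.
move=> [b Hb]; apply: ub_le_sup; last by exists T.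
by exists b => _ [T' _ <-].
Qed.

Lemma limit_value_le W v b : (forall T, value T W v <= b) -> limit_value W v <= b.
Proof.
move=> H; apply: ge_sup; first by exists (value 0 W v), 0%N.
by move=> _ [T _ <-].
Qed.

Lemma limit_value_ge0 W v : bounded_value W v -> 0 <= limit_value W v.
Proof. by move=> b; apply: le_trans (limit_value_ge 0 b); exact: value_ge0. Qed.

Lemma value_cvg W v : bounded_value W v ->
  (value T W v @[T --> \oo] --> limit_value W v)%classic.
Proof.
move=> [b Hb]; apply: nondecreasing_cvgn.
  by move=> T T' h; apply: value_mono.
by exists b => _ [T _ <-].
Qed.

(** The bound on the backup passes to the limit, and each of its terms obeys it too: a successor of
    probability p > 0 other than [y] has value at most [limit_value W v] divided by p. *)
Lemma recurrent_bounded u : (forall T0, exists2 T, (T0 <= T)%N &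
    forall W v, value T.+1 W v = backup u (value T) W v) ->
  forall W v, bounded_value W v ->
  (forall A, step_prob M W A != 0 -> u (push W A) v != y ->
     bounded_value (push W A) (u (push W A) v)) /\
  backup u limit_value W v <= limit_value W v.
Proof.
move=> Hu W v bv.
(* The identity is known only at recurrent horizons; monotonicity carries the bound down from one of
   them to every [T]. *)
have le1 T : backup u (value T) W v <= limit_value W v.
  have [T' TT' E] := Hu T; apply: le_trans (limit_value_ge T'.+1 bv).
  by rewrite E le_backup // => W' v'; apply: value_mono.
have bd A : step_prob M W A != 0 -> u (push W A) v != y ->
     bounded_value (push W A) (u (push W A) v).
  move=> pA uA; have p0 : 0 < step_prob M W A by rewrite lt_def pA step_prob_ge0.
  exists (limit_value W v / step_prob M W A) => T.
  rewrite ler_pdivlMr // mulrC; apply: le_trans (le1 T).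
  rewrite /backup (bigD1 A) //= /stopped (negbTE uA).
  rewrite addrCA lerDl addr_ge0 // sumr_ge0 // => A' _.
  by rewrite mulr_ge0 ?step_prob_ge0 //; case: ifP => _ //; apply: value_ge0.
split=> //.
have cv : (backup u (value T) W v @[T --> \oo] --> backup u limit_value W v)%classic.
  apply: cvgD; first exact: cvg_cst.
  apply: (cvg_sum_seq (F := fun A T =>
    step_prob M W A * stopped (value T) (push W A) (u (push W A) v))) => A.
  (* A successor of probability 0 may have unbounded values, so its term has to vanish before the
     limit is taken. *)
  have [->|pA] := eqVneq (step_prob M W A) 0.
    by rewrite mul0r; under eq_fun do rewrite mul0r; exact: cvg_cst.
  apply: cvgMr; rewrite /stopped; case: (eqVneq (u (push W A) v) y) => uA.
    exact: cvg_cst.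
  by apply: value_cvg; apply: bd.
rewrite -(cvg_lim _ cv) //; apply: limr_le; first by apply/cvg_ex; eexists; exact: cv.
by near=> T.
Unshelve. all: by end_near.
Qed.

End ValueIteration.

(** * Tail probabilities of the arrival time *)

Section Evolution.
Variables (R : realType) (k n m : nat) (M : stgraph R k n m) (s y : 'I_n).
Hypothesis k_gt0 : (0 < k)%N.
Hypothesis sy : s != y.
Variables (d : measure_display) (Omega : measurableType d).
Variables (P : probability Omega R) (X : nat -> Omega -> snapshot m).
Hypothesis evol : is_evolution M P X.
Variable pi : policy k n m.
Local Open Scope classical_set_scope.

(* The probability of not being at [y] during the [T] steps after time [t]. *)
Fixpoint survive T t (W : window k m) (v : 'I_n) : R :=
  if T is T'.+1 then
    \sum_A step_prob M W A *
      stopped y (survive T' t.+1) (push W A) (pi t (push W A) v)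
  else 1.

(** As a sum of tail probabilities this is the expected value of min(remaining time, [T]), for Alice
    at [v] different from [y] at time [t]. *)
Definition truncated T t W v := \sum_(i < T) survive i t W v.

Lemma truncatedS T t W v :
  truncated T.+1 t W v = backup M y (pi t) (truncated T t.+1) W v.
Proof.
rewrite /truncated big_ord_recl /=; congr (1 + _).
rewrite exchange_big /=; apply: eq_bigr => A _; rewrite -mulr_sumr; congr (_ * _).
by rewrite /stopped; case: ifP => // _; rewrite big1.
Qed.

(** The time dependence of [pi] does no harm: each step of value iteration minimizes afresh and so
    is below the backup by the current [pi t]. *)
Lemma value_le_truncated T t W v : legal M pi ->
  value M y T W v <= truncated T t W v.
Proof.
move=> lpi; elim: T t W v => [|T IH] t W v; first by rewrite /truncated big_ord0.
rewrite truncatedS; apply: (@le_trans _ _ (backup M y (pi t) (value M y T) W v)).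
  apply: backup_greedy => // W' v'.
  by case: (lpi t W' v') => [->|h]; rewrite /move_ok ?eqxx // h orbT.
by apply: le_backup => W' v'; exact: IH.
Qed.

Definition path_event t (g : nat -> snapshot m) : set Omega :=
  [set w | forall i, (0 < i <= t)%N -> X i w = g i].

Definition not_arrived t : set Omega :=
  [set w | forall i, (i <= t)%N -> position (init M) (X ^~ w) pi s i != y].

Definition extend t (g : nat -> snapshot m) A i := if i == t.+1 then A else g i.

Lemma path_event_split t g T : path_event t g `&` not_arrived (t + T.+1) =
  \bigcup_(A in [set: snapshot m])
     (path_event t.+1 (extend t g A) `&` not_arrived (t.+1 + T)).
Proof.
rewrite addSnnS; apply/seteqP; split=> [w [h1 h2]|w [A _ [h1 h2]]].
  exists (X t.+1 w) => //; split=> // i /andP[i0 it].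
  rewrite /extend; case: eqP => [->//|/eqP ne]; apply: h1.
  by rewrite i0 -ltnS ltn_neqAle ne it.
split=> // i /andP[i0 it]; rewrite h1 ?i0 ?leqW // /extend.
by case: eqP => // h; move: it; rewrite h ltnn.
Qed.

Lemma path_event_position t g w j : path_event t g w -> (j <= t)%N ->
  position (init M) (X ^~ w) pi s j = position (init M) g pi s j.
Proof.
move=> h jt; apply: position_ext => i /andP[i0 ij]; apply: h.
by rewrite i0 (leq_trans ij).
Qed.

Lemma measurable_path_event t g : measurable (path_event t g).
Proof.
case: evol => mX _; elim: t => [|t IH].
  rewrite (_ : path_event 0 g = setT) //; apply/seteqP; split=> // w _ i.
  by case: i.
rewrite (_ : path_event t.+1 g = path_event t g `&` [set w | X t.+1 w = g t.+1]).
  by apply: measurableI => //; exact: mX.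
apply/seteqP; split=> [w h|w [h1 h2] i /andP[i0]].
  split=> [i /andP[i0 it]|]; last by apply: h => /=.
  by apply: h; rewrite i0 leqW.
rewrite leq_eqVlt => /orP[/eqP ->//|it]; apply: h1; by rewrite i0.
Qed.

(* Backward induction on [T]: splitting on the snapshot at time [t + 1] uses
   the evolution law only for events fixing a whole path. *)
Lemma survive_event T t g :
  (forall i, (i <= t)%N -> position (init M) g pi s i != y) ->
  measurable (path_event t g `&` not_arrived (t + T)) /\
  P (path_event t g `&` not_arrived (t + T)) =
  (P (path_event t g) *
   (survive T t (window_at (init M) g t) (position (init M) g pi s t))%:E)%E.
Proof.
elim: T t g => [|T IH] t g H.
  rewrite addn0 (_ : _ `&` _ = path_event t g).
    by split; [exact: measurable_path_event|rewrite mule1].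
  apply/seteqP; split=> [w []//|w h]; split=> // i it.
  by rewrite (path_event_position h it) H.
pose g' A := extend t g A.
have g'g A i : (0 < i <= t)%N -> g' A i = g i.
  by move=> /andP[_ it]; rewrite /g' /extend; case: eqP it => // ->; rewrite ltnn.
have g't A : g' A t.+1 = A by rewrite /g' /extend eqxx.
have wg' A : window_at (init M) (g' A) t.+1 = push (window_at (init M) g t) A.
  by rewrite window_atS // g't (window_at_ext _ (g'g A)).
have pg' A : position (init M) (g' A) pi s t.+1 =
    pi t (push (window_at (init M) g t) A) (position (init M) g pi s t).
  by rewrite /= wg' (position_ext _ _ _ (g'g A)).
have pe A : P (path_event t.+1 (g' A)) =
    (P (path_event t g) * (step_prob M (window_at (init M) g t) A)%:E)%E.
  case: evol => _ ev; rewrite /path_event ev g't (window_at_ext _ (g'g A)).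
  congr (P _ * _)%E; apply/seteqP; split=> w h i it; rewrite h // g'g //.
pose F A := path_event t.+1 (g' A) `&` not_arrived (t.+1 + T).
pose W := window_at (init M) g t; pose v := position (init M) g pi s t.
(* If the move prescribed after [A] leads to [y], the event is empty, in agreement with the value 0
   of [stopped]. *)
have key A : measurable (F A) /\ P (F A) = (P (path_event t g) *
    (step_prob M W A * stopped y (survive T t.+1) (push W A) (pi t (push W A) v))%:E)%E.
  case: (eqVneq (pi t (push W A) v) y) => E.
    have F0 : F A = set0.
      apply/seteqP; split=> // w [h1 h2]; have := h2 t.+1 (leq_addr _ _).
      by rewrite (path_event_position h1) // pg' E eqxx.
    by rewrite F0 measure0 /stopped E eqxx mulr0 mule0.
  have [|m1 m2] := IH t.+1 (g' A).
    move=> i; rewrite leq_eqVlt => /orP[/eqP ->|it]; first by rewrite pg'.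
    rewrite (_ : position _ _ _ _ _ = position (init M) g pi s i) ?H //.
    apply: position_ext => j /andP[j0 ji]; apply: g'g; rewrite j0.
    exact: leq_trans ji it.
  split=> //; rewrite m2 pe wg' pg' /stopped (negbTE E) EFinM muleA //.
rewrite path_event_split; split.
  by apply: fin_bigcup_measurable => // A _; have [] := key A.
rewrite measure_fin_bigcup; last 3 first.
- exact: finite_finset.
- move=> A B _ _ [w [[h1 _] [h2 _]]].
  have e1 : X t.+1 w = g' A t.+1 by apply: h1; rewrite /= leqnn.
  have e2 : X t.+1 w = g' B t.+1 by apply: h2; rewrite /= leqnn.
  by rewrite -(g't A) -e1 e2 g't.
- by move=> A _; have [] := key A.
rewrite (@fsbigE _ _ _ _ setT (index_enum (snapshot m))) ?index_enum_uniq //; last first.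
  by move=> A _; rewrite mem_index_enum.
rewrite /= -sumEFin ge0_sume_distrr; last first.
  move=> A _; rewrite lee_fin mulr_ge0 ?step_prob_ge0 // /stopped; case: ifP => // _.
  elim: T t.+1 (push _ _) (pi _ _ _) {IH F key} => [|T IH] t' W' v' //=.
  apply: sumr_ge0 => B _; rewrite mulr_ge0 ?step_prob_ge0 // /stopped.
  by case: ifP.
by apply: eq_big => [A|A _]; [rewrite in_setT|have [_ ->] := key A].
Qed.

Lemma not_arrived_prob t : measurable (not_arrived t) /\
  P (not_arrived t) = (survive t 0 (init M) s)%:E.
Proof.
have E0 g : path_event 0 g = setT.
  by apply/seteqP; split=> // w _ [].
(* At time 0 a path event imposes no condition, so any path serves. *)
have [i|] := @survive_event t 0 (fun=> finset.set0).
  by rewrite leqn0 => /eqP ->.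
by rewrite E0 setTI add0n window_at0 probability_setT mul1e.
Qed.

(** The arrival time counts the times at which [y] has not been visited yet; if [y] is never
    reached, every term is 1 and both sides are infinite. *)
Lemma arrival_series w :
  arrival R (init M) (X ^~ w) pi s y =
  (\sum_(t <oo) (\1_(not_arrived t) w)%:E)%E.
Proof.
have ind t : (\1_(not_arrived t) w : R) = (w \in not_arrived t)%:R by rewrite indicE.
have [[t0 ht0]|H] := pselect (exists t, position (init M) (X ^~ w) pi s t == y).
  have ex : exists t, position (init M) (X ^~ w) pi s t == y by exists t0.
  pose T := ex_minn ex.
  have [hT minT] : position (init M) (X ^~ w) pi s T == y /\
     (forall t, position (init M) (X ^~ w) pi s t == y -> (T <= t)%N).
    by rewrite /T; case: ex_minnP.
  have na t : (w \in not_arrived t) = (t < T)%N.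
    apply/idP/idP => [/set_mem h|tT].
      by rewrite ltnNge; apply/negP => /h; rewrite hT.
    apply/mem_set => i it; apply/negP => /minT; lia.
  rewrite (nneseries_split 0 T) // add0n eseries0 ?adde0; last first.
    by move=> i Ti _; rewrite ind na ltnNge Ti.
  rewrite (eq_big_nat _ _ (F2 := fun=> 1%:E)); last first.
    by move=> i /andP[_ iT]; rewrite ind na iT.
  rewrite sumEFin big_const_nat subn0.
  apply/eqP; rewrite eq_le; apply/andP; split.
    apply: ereal_inf_lbound; exists T; first exact/eqP.
    by rewrite iter_addr addr0.
  apply: le_ereal_inf_tmp => _ [t /eqP ht <-].
  by rewrite iter_addr addr0 lee_fin ler_nat minT.
have na t : w \in not_arrived t.
  by apply/mem_set => i _; apply/negP => h; apply: H; exists i.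
rewrite /arrival (_ : [set t | position (init M) (X ^~ w) pi s t = y] = set0).
  rewrite image_set0 ereal_inf0; apply/esym/eq_infty => r.
  apply: (@le_trans _ _ (\sum_(0 <= t < Num.bound `|r|) (\1_(not_arrived t) w)%:E)%E).
    rewrite (eq_big_nat _ _ (F2 := fun=> 1%:E)); last by move=> i _; rewrite ind na.
    rewrite sumEFin lee_fin big_const_nat subn0 iter_addr addr0.
    by apply: le_trans (ler_norm _) _; apply: ltW; exact: archi_boundP.
  by apply: nneseries_lim_ge.
by apply/seteqP; split=> // t /eqP h; apply: H; exists t.
Qed.

(** Exchanging the integral with a series of non-negative indicators requires measurability of the
    events [not_arrived t] only. *)
Lemma expected_arrival_series :
  expected_arrival M P X pi s y = (\sum_(t <oo) (survive t 0 (init M) s)%:E)%E.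
Proof.
rewrite /expected_arrival.
under eq_integral do rewrite arrival_series.
rewrite integral_nneseries //; last first.
  move=> t; apply/measurable_EFinP; apply: measurable_indic.
  by have [] := not_arrived_prob t.
apply: eq_eseriesr => t _; have [mt <-] := not_arrived_prob t.
by rewrite integral_indic // setIT.
Qed.

Lemma survive_ge0 T t W v : 0 <= survive T t W v.
Proof.
elim: T t W v => [|T IH] t W v //=.
apply: sumr_ge0 => A _; rewrite mulr_ge0 ?step_prob_ge0 // /stopped.
by case: ifP.
Qed.

Lemma truncated_le_expected T :
  ((truncated T 0 (init M) s)%:E <= expected_arrival M P X pi s y)%E.
Proof.
rewrite expected_arrival_series /truncated -sumEFin -(big_mkord xpredT
  (fun i => (survive i 0 (init M) s)%:E)).
by apply: nneseries_lim_ge => i _ _; rewrite lee_fin survive_ge0.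
Qed.

Lemma expected_le_bound (b : R) :
  (forall T, truncated T 0 (init M) s <= b) ->
  (expected_arrival M P X pi s y <= b%:E)%E.
Proof.
move=> H; rewrite expected_arrival_series; apply: lime_le.
  by apply: is_cvg_nneseries => i _ _; rewrite lee_fin survive_ge0.
by apply: nearW => T; rewrite big_mkord sumEFin lee_fin; exact: H.
Qed.

End Evolution.

(** * From truncated values to the optimal expected arrival time *)

Section Best.
Variables (R : realType) (k n m : nat) (M : stgraph R k n m) (s y : 'I_n).
Hypothesis k_gt0 : (0 < k)%N.
Hypothesis sy : s != y.
Variables (d : measure_display) (Omega : measurableType d).
Variables (P : probability Omega R) (X : nat -> Omega -> snapshot m).
Hypothesis evol : is_evolution M P X.

Lemma value_le_expected pi T : legal M pi ->
  ((value M y T (init M) s)%:E <= expected_arrival M P X pi s y)%E.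
Proof.
move=> lpi; apply: le_trans (truncated_le_expected k_gt0 sy evol pi T).
by rewrite lee_fin value_le_truncated.
Qed.

Lemma is_best_infinite :
  (forall b, exists T, b < value M y T (init M) s) ->
  is_best M P X s y +oo%E.
Proof.
move=> H.
have inf pi : legal M pi -> expected_arrival M P X pi s y = +oo%E.
  move=> lpi; apply: eq_infty => r; have [T hT] := H r.
  by apply: le_trans (value_le_expected T lpi); rewrite lee_fin ltW.
split; last by move=> pi /inf ->.
have stay : legal M (fun _ _ v => v) by move=> t W v; left.
by exists (fun _ _ v => v) => //; exact: inf.
Qed.

(** Here [b] is the supremum of the truncated values. It is attained by a recurrent greedy [u]:
    since the limit value dominates its own backup by [u], it dominates every truncated expectation
    of the stationary policy [u]. The induction visits only bounded states, where the limit value is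
    meaningful. *)
Lemma is_best_finite b :
  (forall T, value M y T (init M) s <= b) ->
  (forall b', (forall T, value M y T (init M) s <= b') -> b <= b') ->
  is_best M P X s y b%:E.
Proof.
move=> ub lub.
have low pi : legal M pi -> (b%:E <= expected_arrival M P X pi s y)%E.
  move=> lpi; case: (leP b%:E (expected_arrival M P X pi s y)) => // h.
  have fin : expected_arrival M P X pi s y \is a fin_num.
    rewrite fin_numE; apply/andP; split; last by move: h; case: expected_arrival.
    have := value_le_expected 0 lpi; by case: expected_arrival.
  (* A finite expectation below [b] would be a smaller bound on all truncated values. *)
  move: h; rewrite -(fineK fin) lte_fin ltNge lub // => T.
  by rewrite -lee_fin fineK // value_le_expected.
split; last exact: low.
have [u lu Hu] := recurrent_greedy M y.
have lpi : legal M (fun=> u).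
  by move=> t W v; have /orP[/eqP|] := lu W v; [left|right].
exists (fun=> u) => //; apply/eqP; rewrite eq_le low // andbT.
have bs : bounded_value M y (init M) s by exists b.
suff H T t W v : bounded_value M y W v ->
    truncated M y (fun=> u) T t W v <= limit_value M y W v.
  apply: expected_le_bound => // T.
  by apply: le_trans (H T 0%N _ _ bs) _; exact: limit_value_le.
elim: T t W v => [|T IH] t W v bv.
  by rewrite /truncated big_ord0; exact: limit_value_ge0.
have [b1 b2] := recurrent_bounded k_gt0 Hu bv.
apply: le_trans b2; rewrite truncatedS lerD2l ler_sum // => A _.
have [->|pA] := eqVneq (step_prob M W A) 0; first by rewrite !mul0r.
rewrite ler_wpM2l ?step_prob_ge0 // /stopped.
case: (eqVneq (u (push W A) v) y) => // uA.
by apply: IH; exact: b1.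
Qed.

End Best.

(** Alice can only stay, and the empty snapshot has probability 1 as an empty product. *)
Lemma value_no_edges (R : realType) (k n : nat) (M : stgraph R k n 0)
    (y : 'I_n) T W v : (0 < k)%N -> v != y -> value M y T W v = T%:R.
Proof.
move=> k0; elim: T W v => [//|T IH] W v vy /=; rewrite /backup.
rewrite (big_pred1 finset.set0); last first.
  by move=> A; rewrite /=; apply/esym/eqP/setP; case.
rewrite /step_prob big_ord0 mul1r.
have -> : greedy M y (value M y T) (push W finset.set0) v = v.
  have /orP[/eqP //|] := @greedy_allowed R k n 0 M y (value M y T) (push W finset.set0) v.
  by rewrite /Defs.adjacent => /existsP[[]].
by rewrite /stopped (negbTE vy) IH // -natr1 addrC.
Qed.

Local Close Scope ring_scope.

(** * Gauss-Jordan elimination on x = c + Q x *)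
Local Open Scope ring_scope.

Section Elimination.
Variables (R : realType) (N : nat).
Implicit Types (Q : nat -> nat -> R) (c x : nat -> R) (F : nat -> bool).

Definition pivot_row j Q l := if l == j then 0 else Q j l / (1 - Q j j).

(** Equation [j] is solved for [x j] and substituted into the other equations, so the system keeps
    its fixed-point form x = c + Q x. *)
Definition elim_mx j Q i l :=
  if 1 <= Q j j then Q i l
  else if i == j then pivot_row j Q l
  else (if l == j then 0 else Q i l) + Q i j * pivot_row j Q l.

Definition elim_rhs j Q c i :=
  if 1 <= Q j j then c i
  else if i == j then c j / (1 - Q j j)
  else c i + Q i j * (c j / (1 - Q j j)).

Definition positive_system Q c :=
  forall i, (i < N)%N -> 0 < c i /\ forall l, (l < N)%N -> 0 <= Q i l.

Definition sub_solution Q c x :=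
  forall i, (i < N)%N -> x i <= c i + \sum_(l < N) Q i l * x l.

(* [F] is the set of indices where the solution is finite. *)
Definition super_solution F Q c x :=
  forall i, (i < N)%N -> F i ->
    c i + \sum_(l < N) Q i l * x l <= x i /\
    (forall l, (l < N)%N -> ~~ F l -> Q i l = 0).

Definition cleared F j Q :=
  forall j', (j' < j)%N -> F j' -> forall i, (i < N)%N -> Q i j' = 0.

Variable j : nat.
Hypothesis jN : (j < N)%N.

Lemma positive_elim Q c : positive_system Q c ->
  positive_system (elim_mx j Q) (elim_rhs j Q c).
Proof.
move=> H i iN; have [ci Qi] := H i iN; have [cj Qj] := H j jN.
rewrite /elim_mx /elim_rhs; case: (leP 1 (Q j j)) => [//|q1].
have p0 : 0 < 1 - Q j j by lra.
have r0 l : (l < N)%N -> 0 <= pivot_row j Q l.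
  by move=> lN; rewrite /pivot_row; case: ifP => // _; rewrite divr_ge0 ?Qj // ltW.
have c0 : 0 < c j / (1 - Q j j) by rewrite divr_gt0.
case: ifP => _; first by split=> // l /r0.
split; first by rewrite ltr_wpDr // mulr_ge0 ?Qi // ltW.
move=> l lN; rewrite addr_ge0 // ?mulr_ge0 ?Qi ?r0 //.
by case: ifP => // _; rewrite Qi.
Qed.

Lemma sum_pivot_row Q x : \sum_(l < N) pivot_row j Q l * x l =
  (\sum_(l < N) Q j l * x l - Q j j * x j) / (1 - Q j j).
Proof.
rewrite (bigD1 (Ordinal jN)) //= [in RHS](bigD1 (Ordinal jN)) //=.
rewrite /pivot_row eqxx mul0r add0r addrAC subrr add0r mulr_suml; apply: eq_bigr => l lj.
rewrite ifN; first by rewrite mulrAC.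
by apply: contra lj => /eqP h; apply/eqP/val_inj.
Qed.

Lemma sum_elim_row Q x i :
  \sum_(l < N) ((if l == j :> nat then 0 else Q i l) + Q i j * pivot_row j Q l) * x l =
  \sum_(l < N) Q i l * x l - Q i j * x j +
    Q i j * ((\sum_(l < N) Q j l * x l - Q j j * x j) / (1 - Q j j)).
Proof.
under eq_bigr do rewrite mulrDl -mulrA.
rewrite big_split /= -mulr_sumr sum_pivot_row; congr (_ + _).
rewrite (bigD1 (Ordinal jN)) //= [in RHS](bigD1 (Ordinal jN)) //=.
rewrite eqxx mul0r add0r addrAC subrr add0r; apply: eq_bigr => l lj.
by rewrite ifN.
Qed.

(** Division by [1 - Q j j > 0] and substitution with the coefficient [Q i j >= 0] both preserve the
    direction of the inequality. *)
Lemma sub_elim Q c x : positive_system Q c -> sub_solution Q c x ->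
  sub_solution (elim_mx j Q) (elim_rhs j Q c) x.
Proof.
move=> H S i iN; have [ci Qi] := H i iN.
have := S j jN; have := S i iN; rewrite /elim_mx /elim_rhs.
case: (leP 1 (Q j j)) => [//|q1].
set Si := \sum_(l < N) Q i l * x l; set Sj := \sum_(l < N) Q j l * x l.
have p0 : 0 < 1 - Q j j by lra.
move=> hi hj.
have le : x j <= c j / (1 - Q j j) + (Sj - Q j j * x j) / (1 - Q j j).
  by rewrite -mulrDl ler_pdivlMr //; lra.
case: (eqVneq i j) => [->|ij]; first by rewrite sum_pivot_row.
rewrite sum_elim_row -/Si -/Sj.
have := ler_wpM2l (Qi j jN) le; rewrite mulrDr; lra.
Qed.

(** Otherwise [x j] would be at least [c j + x j], contrary to [c j > 0]. Hence no pivot of finite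
    index is skipped. *)
Lemma super_pivot F Q c x : positive_system Q c -> (forall i, 0 <= x i) ->
  super_solution F Q c x -> F j -> Q j j < 1.
Proof.
move=> H x0 S Fj; have [cj Qj] := H j jN; have [+ _] := S j jN Fj.
rewrite (bigD1 (Ordinal jN)) //=.
set D := \sum_(_ < N | _) _ => h.
have D0 : 0 <= D by apply: sumr_ge0 => l _; rewrite mulr_ge0 ?Qj.
case: (ltP (Q j j) 1) => // q1.
have := ler_wpM2r (x0 j) q1; lra.
Qed.

Lemma super_elim F Q c x : positive_system Q c -> (forall i, 0 <= x i) ->
  super_solution F Q c x -> super_solution F (elim_mx j Q) (elim_rhs j Q c) x.
Proof.
move=> H x0 S i iN Fi; have [hi zi] := S i iN Fi; have [ci Qi] := H i iN.
move: hi; rewrite /elim_mx /elim_rhs.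
case: (leP 1 (Q j j)) => [//|q1].
have p0 : 0 < 1 - Q j j by lra.
have nj (Fj : F j) l : (l < N)%N -> ~~ F l -> pivot_row j Q l = 0.
  move=> lN Fl; rewrite /pivot_row; case: ifP => // _.
  by have [_ /(_ l lN Fl) ->] := S j jN Fj; rewrite mul0r.
set Si := \sum_(l < N) Q i l * x l; set Sj := \sum_(l < N) Q j l * x l => hi.
have le : F j -> c j / (1 - Q j j) + (Sj - Q j j * x j) / (1 - Q j j) <= x j.
  move=> Fj; have [hj _] := S j jN Fj.
  by rewrite -mulrDl ler_pdivrMr //; move: hj; rewrite -/Sj; lra.
case: (eqVneq i j) => [ij|ij].
  by rewrite sum_pivot_row -/Sj; move: Fi; rewrite ij => Fj; split; [exact: le|exact: nj].
rewrite sum_elim_row -/Si -/Sj.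
case: (boolP (F j)) => Fj.
  split; first by have := ler_wpM2l (Qi j jN) (le Fj); rewrite mulrDr; lra.
  move=> l lN Fl; rewrite (nj Fj) // mulr0 addr0 zi //; by case: ifP.
(* The finite row [i] has coefficient 0 at the infinite index [j], so this step does not change
   it. *)
rewrite (zi j jN Fj); split; first by lra.
by move=> l lN Fl; rewrite mul0r addr0 zi //; case: ifP.
Qed.

(** A column cleared earlier stays zero because the pivot row is zero there as well; column [j] is
    cleared because its pivot is not skipped. *)
Lemma cleared_elim F Q c x : positive_system Q c -> (forall i, 0 <= x i) ->
  super_solution F Q c x -> cleared F j Q -> cleared F j.+1 (elim_mx j Q).
Proof.
move=> H x0 S C j'; rewrite ltnS leq_eqVlt => /orP[/eqP ->|j'j] Fj i iN.
  have := super_pivot H x0 S Fj; rewrite /elim_mx ltNge => /negbTE ->.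
  by rewrite /pivot_row eqxx mulr0 addr0; case: ifP.
have E : (j' == j) = false by rewrite ltn_eqF.
rewrite /elim_mx /pivot_row E !(C j' j'j Fj) // mul0r mulr0 addr0.
by case: ifP => // _; case: ifP.
Qed.

End Elimination.

(** * Outcome of the complete elimination *)

Section Elimination_steps.
Variables (R : realType) (N : nat) (Q : nat -> nat -> R) (c : nat -> R).
Implicit Types (x : nat -> R) (F : nat -> bool).

Fixpoint elim_steps q : (nat -> nat -> R) * (nat -> R) :=
  if q is q'.+1 then
    (elim_mx q' (elim_steps q').1, elim_rhs q' (elim_steps q').1 (elim_steps q').2)
  else (Q, c).

Hypothesis pos : positive_system N Q c.

Lemma positive_steps q : (q <= N)%N ->
  positive_system N (elim_steps q).1 (elim_steps q).2.
Proof. by elim: q => [//|q IH] qN /=; apply: positive_elim => //; exact/IH/ltnW. Qed.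

Lemma sub_steps x q : (q <= N)%N -> sub_solution N Q c x ->
  sub_solution N (elim_steps q).1 (elim_steps q).2 x.
Proof.
move=> + S; elim: q => [//|q IH] qN /=; apply: sub_elim => //.
  exact/positive_steps/ltnW.
exact/IH/ltnW.
Qed.

Lemma super_steps F x q : (q <= N)%N -> (forall i, 0 <= x i) ->
  super_solution N F Q c x ->
  super_solution N F (elim_steps q).1 (elim_steps q).2 x /\
  cleared N F q (elim_steps q).1.
Proof.
move=> + x0 S; elim: q => [//|q IH] qN /=.
have [S' C'] := IH (ltnW qN); have P := positive_steps (ltnW qN).
by split; [exact: super_elim|exact: cleared_elim x0 S' C'].
Qed.

(** With non-negative entries this says that row [i] vanishes; each inequality is a single test of
    the machine. *)
Definition solved i := forall l, (l < N)%N -> (elim_steps N).1 i l <= 0.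

Lemma solved_sub x i : (i < N)%N -> solved i -> sub_solution N Q c x ->
  x i <= (elim_steps N).2 i.
Proof.
move=> iN sv S; have := sub_steps (leqnn N) S iN.
rewrite big1 ?addr0 // => l _.
have [_ Qi] := positive_steps (leqnn N) iN.
have -> : (elim_steps N).1 i l = 0 by apply/le_anti; rewrite sv //= Qi.
by rewrite mul0r.
Qed.

(** In a finite row the columns of finite index have been cleared by elimination, and those of
    infinite index vanish by the definition of super-solution. *)
Lemma solved_super F x i : (i < N)%N -> F i -> (forall i, 0 <= x i) ->
  super_solution N F Q c x -> solved i /\ (elim_steps N).2 i <= x i.
Proof.
move=> iN Fi x0 S; have [S' C'] := super_steps (leqnn N) x0 S.
have [h z] := S' i iN Fi.
have z0 l : (l < N)%N -> (elim_steps N).1 i l = 0.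
  by move=> lN; case: (boolP (F l)) => Fl; [exact: C'|exact: z].
split; first by move=> l /z0 ->.
by move: h; rewrite big1 ?addr0 // => l _; rewrite z0 // mul0r.
Qed.

End Elimination_steps.

Local Close Scope ring_scope.

(** * For-loop programs *)

(** With bounded loops only, a program has a total meaning [run] and a time bound computed from its
    syntax, so correctness and cost are proved separately. *)
Inductive lcmd : Type :=
| LSkip
| LN of nat & nexp & nexp
| LR of nat & nexp & rexp
| LSeq of lcmd & lcmd
| LIf of test & lcmd & lcmd
(* [LFor i b c] runs [c] with cell [i] counting up to the value of cell [b]. *)
| LFor of nat & nat & lcmd.

Definition cell (a : nat) : nexp := NGet a (NConst 0).

Fixpoint compile (c : lcmd) : cmd :=
  match c with
  | LSkip => Skip
  | LN a i e => NSet a i e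
  | LR a i e => RSet a i e
  | LSeq c1 c2 => Seq (compile c1) (compile c2)
  | LIf b c1 c2 => If b (compile c1) (compile c2)
  | LFor i b c1 =>
      Seq (NSet i (NConst 0) (NConst 0))
        (While (NLe (NAdd (cell i) (NConst 1)) (cell b))
           (Seq (compile c1)
              (NSet i (NConst 0) (NAdd (cell i) (NConst 1)))))
  end.

Definition setn (R : realType) (sg : memory R) (a i x : nat) : memory R :=
  Memory (update (nmem sg) a i x) (rmem sg).

Definition setr (R : realType) (sg : memory R) (a i : nat) (x : R) :
    memory R :=
  Memory (nmem sg) (update (rmem sg) a i x).

Fixpoint run (R : realType) (c : lcmd) (sg : memory R) : memory R :=
  match c with
  | LSkip => sg
  | LN a i e => setn sg a (neval sg i) (neval sg e)
  | LR a i e => setr sg a (neval sg i) (reval sg e)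
  | LSeq c1 c2 => run c2 (run c1 sg)
  | LIf b c1 c2 => if teval sg b then run c1 sg else run c2 sg
  | LFor i b c1 =>
      iteri (nmem sg b 0) (fun j sg' => setn (run c1 sg') i 0 j.+1)
        (setn sg i 0 0)
  end.

Fixpoint nwrites (c : lcmd) : seq nat :=
  match c with
  | LSkip | LR _ _ _ => [::]
  | LN a _ _ => [:: a]
  | LSeq c1 c2 | LIf _ c1 c2 => nwrites c1 ++ nwrites c2
  | LFor i _ c1 => i :: nwrites c1
  end.

Fixpoint rwrites (c : lcmd) : seq nat :=
  match c with
  | LSkip | LN _ _ _ => [::]
  | LR a _ _ => [:: a]
  | LSeq c1 c2 | LIf _ c1 c2 => rwrites c1 ++ rwrites c2
  | LFor _ _ c1 => rwrites c1
  end.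

Fixpoint lbounds (c : lcmd) : seq nat :=
  match c with
  | LSkip | LN _ _ _ | LR _ _ _ => [::]
  | LSeq c1 c2 | LIf _ c1 c2 => lbounds c1 ++ lbounds c2
  | LFor _ b c1 => b :: lbounds c1
  end.

(** A loop body may write neither its counter nor its bound; then the compiled loop, which rereads
    both at every test, makes the number of turns fixed at entry. *)
Fixpoint wf (c : lcmd) : bool :=
  match c with
  | LSkip | LN _ _ _ | LR _ _ _ => true
  | LSeq c1 c2 | LIf _ c1 c2 => wf c1 && wf c2
  | LFor i b c1 =>
      [&& i \notin nwrites c1, b \notin i :: nwrites c1 & wf c1]
  end.

(** [B] is to bound all loop bounds. A loop pays 3 for the initialization and 7 for the failing
    test, then 7 + 6 per turn for test and increment. *)
Fixpoint tmax (B : nat) (c : lcmd) : nat :=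
  match c with
  | LSkip => 1
  | LN _ i e => (ncost i + ncost e).+1
  | LR _ i e => (ncost i + rcost e).+1
  | LSeq c1 c2 => tmax B c1 + tmax B c2
  | LIf b c1 c2 => tcost b + tmax B c1 + tmax B c2
  | LFor _ _ c1 => 10 + B * (13 + tmax B c1)
  end.

Fixpoint depth (c : lcmd) : nat :=
  match c with
  | LSkip | LN _ _ _ | LR _ _ _ => 0
  | LSeq c1 c2 | LIf _ c1 c2 => maxn (depth c1) (depth c2)
  | LFor _ _ c1 => (depth c1).+1
  end.

Lemma update_same (T : Type) (f : nat -> nat -> T) a i x :
  update f a i x a i = x.
Proof. by rewrite /update !eqxx. Qed.

Lemma update_array (T : Type) (f : nat -> nat -> T) a i x b :
  b != a -> update f a i x b = f b.
Proof. by move=> /negbTE ba; apply/funext => j; rewrite /update ba. Qed.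

Section Run.
Variable R : realType.
Implicit Types (sg : memory R) (c : lcmd).

Lemma run_nframe c sg a : a \notin nwrites c -> nmem (run c sg) a = nmem sg a.
Proof.
elim: c sg => [|a' i e|a' i e|c1 IH1 c2 IH2|b c1 IH1 c2 IH2|i b c IH] /= sg //.
- by rewrite inE => H; rewrite update_array.
- by rewrite mem_cat negb_or => /andP[h1 h2];
    rewrite IH2 // IH1.
- by rewrite mem_cat negb_or => /andP[h1 h2]; case: ifP => _; [apply: IH1|apply: IH2].
- rewrite inE negb_or => /andP[ai ac].
  elim: (nmem sg b 0) => [|n IHn] /=; first by rewrite update_array.
  by rewrite update_array // IH.
Qed.

Lemma run_rframe c sg a : a \notin rwrites c -> rmem (run c sg) a = rmem sg a.
Proof.
elim: c sg => [|a' i e|a' i e|c1 IH1 c2 IH2|b c1 IH1 c2 IH2|i b c IH] /= sg //.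
- by rewrite inE => H; rewrite update_array.
- by rewrite mem_cat negb_or => /andP[h1 h2];
    rewrite IH2 // IH1.
- by rewrite mem_cat negb_or => /andP[h1 h2]; case: ifP => _; [apply: IH1|apply: IH2].
- by move=> ac; elim: (nmem sg b 0) => [|n IHn] //=; rewrite IH.
Qed.

(** The invariant rule. It supplies the counter value and all arrays untouched by the body, so [I]
    mentions only what changes. *)
Lemma run_for_ind (I : nat -> memory R -> Prop) i b c sg :
  wf (LFor i b c) ->
  I 0 (setn sg i 0 0) ->
  (forall j sg', j < nmem sg b 0 -> I j sg' -> nmem sg' i 0 = j ->
    (forall a, a \notin i :: nwrites c -> nmem sg' a = nmem sg a) ->
    (forall a, a \notin rwrites c -> rmem sg' a = rmem sg a) ->
    I j.+1 (setn (run c sg') i 0 j.+1)) ->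
  I (nmem sg b 0) (run (LFor i b c) sg).
Proof.
move=> /= /and3P[ic bc wc] I0 IS.
set N := nmem sg b 0.
suff: forall j, j <= N ->
  let sg' := iteri j (fun j sg' => setn (run c sg') i 0 j.+1) (setn sg i 0 0) in
  [/\ I j sg', nmem sg' i 0 = j,
     forall a, a \notin i :: nwrites c -> nmem sg' a = nmem sg a &
     forall a, a \notin rwrites c -> rmem sg' a = rmem sg a].
  by move=> /(_ N (leqnn N)) [].
elim=> [_|j IH jN] /=.
  split=> //; first by rewrite update_same.
  by move=> a; rewrite inE negb_or => /andP[ai _]; rewrite update_array.
have [h1 h2 h3 h4] := IH (ltnW jN).
split.
- by apply: IS.
- by rewrite update_same.
- move=> a ha; move: (ha); rewrite inE negb_or => /andP[ai ac].
  by rewrite update_array // run_nframe // h3.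
- by move=> a ha; rewrite run_rframe // h4.
Qed.

(** Kept apart from the uniform bound [tmax] because the outer loop makes [n ^ N] turns, while the
    inner loop bounds are at most [N]. *)
Lemma exec_for i b c sg D :
  i \notin nwrites c -> b \notin i :: nwrites c ->
  (forall sg', (forall a, a \notin i :: nwrites c -> nmem sg' a = nmem sg a) ->
     exists2 t, t <= D & exec (compile c) sg' t (run c sg')) ->
  exists2 t, t <= 10 + nmem sg b 0 * (13 + D) &
    exec (compile (LFor i b c)) sg t (run (LFor i b c) sg).
Proof.
move=> ic bc H.
pose sgj j := iteri j (fun j sg' => setn (run c sg') i 0 j.+1) (setn sg i 0 0).
have sgi j : nmem (sgj j) i 0 = j by case: j => [|j] /=; rewrite update_same.
have sgf j a : a \notin i :: nwrites c -> nmem (sgj j) a = nmem sg a.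
  rewrite inE negb_or => /andP[ai ac].
  by elim: j => [|j IH] /=; rewrite update_array // run_nframe // IH.
set N := nmem sg b 0.
have test j : teval (sgj j) (NLe (NAdd (cell i) (NConst 1)) (cell b)) = (j < N).
  by rewrite /= sgi (sgf _ _ bc) addn1.
have loop q : q <= N -> exists2 t, t <= q * (13 + D) + 7 &
    exec (While (NLe (NAdd (cell i) (NConst 1)) (cell b))
           (Seq (compile c)
              (NSet i (NConst 0) (NAdd (cell i) (NConst 1)))))
      (sgj (N - q)) t (sgj N).
  elim: q => [_|q IH qN].
    exists 7 => //; rewrite subn0.
    by apply: (ExecWhileFalse (b := NLe _ _)); rewrite test ltnn.
  have [t1 t1D e1] := H (sgj (N - q.+1)) (sgf _).
  have [t2 t2D e2] := IH (ltnW qN).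
  have E : N - q = (N - q.+1).+1 by lia.
  exists (7 + (t1 + 6) + t2); first by rewrite mulSn; lia.
  apply: (ExecWhileTrue (b := NLe _ _)).
  - by rewrite test; lia.
  - apply: ExecSeq; first exact: e1.
    exact: ExecNSet.
  - move: e2; rewrite E /=.
    rewrite /setn run_nframe // sgi addn1 //=.
have [t tD e] := loop N (leqnn N).
exists (3 + t); first by rewrite -/N; lia.
rewrite subnn in e.
by apply: ExecSeq; [exact: ExecNSet | exact: e].
Qed.

Lemma exec_run c sg B :
  wf c -> {in lbounds c, forall b, nmem sg b 0 <= B /\ b \notin nwrites c} ->
  exists2 t, t <= tmax B c & exec (compile c) sg t (run c sg).
Proof.
elim: c sg => [sg _ _|a i e sg _ _|a i e sg _ _|c1 IH1 c2 IH2 sg|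
    b c1 IH1 c2 IH2 sg|i b c IH sg] /=.
- by exists 1 => //; exact: ExecSkip.
- by exists (ncost i + ncost e).+1 => //; exact: ExecNSet.
- by exists (ncost i + rcost e).+1 => //; exact: ExecRSet.
- move=> /andP[w1 w2] H.
  have [|t1 h1 e1] := IH1 sg w1.
    by move=> b b1; have := H b; rewrite !mem_cat b1 negb_or => -[//|? /andP[]].
  have [|t2 h2 e2] := IH2 (run c1 sg) w2.
    move=> b b1; have := H b; rewrite !mem_cat b1 orbT negb_or.
    by move=> -[//|? /andP[h ?]]; rewrite run_nframe.
  by exists (t1 + t2); [lia|apply: ExecSeq e1 e2].
- move=> /andP[w1 w2] H.
  have [|t1 h1 e1] := IH1 sg w1.
    by move=> d d1; have := H d; rewrite !mem_cat d1 negb_or => -[//|? /andP[]].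
  have [|t2 h2 e2] := IH2 sg w2.
    by move=> d d1; have := H d; rewrite !mem_cat d1 orbT negb_or => -[//|? /andP[]].
  case: ifPn => hb.
    by exists (tcost b + t1); [lia|apply: ExecIfTrue e1].
  by exists (tcost b + t2); [lia|apply: ExecIfFalse e2].
- move=> /and3P[ic bc wc] H.
  have [sg' Hsg'|t tD e] := @exec_for i b c sg (tmax B c) ic bc.
    apply: IH => // d dc; have := H d; rewrite inE dc orbT => -[//|d1 d2].
    rewrite Hsg' //; split=> //.
    by move: d2; rewrite inE negb_or => /andP[].
  exists t => //; apply: leq_trans tD _; rewrite leq_add2l leq_mul2r.
  by have := H b; rewrite inE eqxx => -[//|-> _]; rewrite orbT.
Qed.

Lemma tmax_poly c B : 0 < B -> tmax B c <= tmax 1 c * B ^ depth c.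
Proof.
move=> B0; elim: c => [|a i e|a i e|c1 IH1 c2 IH2|b c1 IH1 c2 IH2|i b c IH] /=;
  rewrite ?expn0 ?muln1 //.
- rewrite mulnDl leq_add //.
    by apply: leq_trans IH1 _; rewrite leq_mul2l leq_pexp2l ?orbT // leq_maxl.
  by apply: leq_trans IH2 _; rewrite leq_mul2l leq_pexp2l ?orbT // leq_maxr.
- rewrite !mulnDl !leq_add //.
  + by rewrite -{1}[tcost b]muln1 leq_mul2l expn_gt0 B0 orbT.
  + by apply: leq_trans IH1 _; rewrite leq_mul2l leq_pexp2l ?orbT // leq_maxl.
  + by apply: leq_trans IH2 _; rewrite leq_mul2l leq_pexp2l ?orbT // leq_maxr.
- have P0 : 0 < B ^ depth c by rewrite expn_gt0 B0.
  have : B * tmax B c <= B * (tmax 1 c * B ^ depth c) by rewrite leq_mul2l IH orbT.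
  rewrite expnS; nia.
Qed.

End Run.

(** * Binary codes of snapshots and windows *)

Definition bit (w b : nat) : bool := odd (w %/ 2 ^ b).

Lemma bit_div w a b : bit (w %/ 2 ^ a) b = bit w (a + b).
Proof. by rewrite /bit -divnMA expnD. Qed.

Lemma half_div_pow w b : (w %/ 2 ^ b)./2 = w %/ 2 ^ b.+1.
Proof. by rewrite -divn2 -divnMA expnSr. Qed.

Lemma bit_sum_lt (f : nat -> bool) q : \sum_(i < q) f i * 2 ^ i < 2 ^ q.
Proof.
elim: q => [|q IH]; first by rewrite big_ord0.
rewrite big_ord_recr /= expnS mul2n -addnn -addSn leq_add //.
by case: (f q); rewrite ?mul1n ?mul0n.
Qed.

(** The high part [c] absorbs the top bit in the induction; it is also the edge number in the index
    of a probability. *)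
Lemma bit_sum (f : nat -> bool) c q j : j < q ->
  bit (c * 2 ^ q + \sum_(i < q) f i * 2 ^ i) j = f j.
Proof.
elim: q c => [//|q IH] c; rewrite ltnS leq_eqVlt big_ord_recr /=.
have -> : c * 2 ^ q.+1 + (\sum_(i < q) f i * 2 ^ i + f q * 2 ^ q) =
    (c.*2 + f q) * 2 ^ q + \sum_(i < q) f i * 2 ^ i.
  by rewrite expnS -mul2n; lia.
case/orP => [/eqP ->|jq]; last exact: IH.
rewrite /bit divnMDl ?expn_gt0 // divn_small ?bit_sum_lt // addn0.
by rewrite oddD odd_double /=; case: (f q).
Qed.

Lemma bit_addM x h q j : j < q -> bit (x + h * 2 ^ q) j = bit x j.
Proof.
move=> jq; rewrite /bit.
have -> : h * 2 ^ q = (h * 2 ^ (q - j.+1)).*2 * 2 ^ j.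
  by rewrite -mul2n -{1}(subnK jq) expnD expnS; lia.
by rewrite divnDMl ?expn_gt0 // oddD odd_double addbF.
Qed.

Section Codes.
Variables (k n m : nat).
Hypothesis k_gt0 : 0 < k.

Definition dec_snap (a : nat) : snapshot m := finset.finset (fun e : 'I_m => bit a e).

(** The oldest snapshot occupies the low bits, so sliding the window is a shift by [m] bits followed
    by an addition at the top, see [next_code]. *)
Definition dec_window (w : nat) : window k m := [tuple dec_snap (w %/ 2 ^ (i * m)) | i < k].

Definition has_edge (A : snapshot m) (j : nat) : bool :=
  [exists e : 'I_m, (e == j :> nat) && (e \in A)].

Lemma has_edgeE (A : snapshot m) (e : 'I_m) : has_edge A e = (e \in A).
Proof.
apply/existsP/idP => [[e' /andP[/eqP/val_inj -> //]]|eA].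
by exists e; rewrite eqxx.
Qed.

Definition enc_snap (A : snapshot m) : nat := \sum_(e < m) has_edge A e * 2 ^ e.

Lemma enc_snap_lt A : enc_snap A < 2 ^ m.
Proof. exact: bit_sum_lt. Qed.

Lemma enc_snapK A : dec_snap (enc_snap A) = A.
Proof.
apply/setP => e; rewrite finset.inE.
have := bit_sum (has_edge A) 0 (ltn_ord e).
by rewrite mul0n add0n has_edgeE.
Qed.

(** Encoding is injective between sets of [2 ^ m] elements, so the loop over codes ranges over all
    snapshots. *)
Lemma sum_codes (R : realType) (G : nat -> R) :
  (\sum_(a < 2 ^ m) G a = \sum_(A : snapshot m) G (enc_snap A))%R.
Proof.
pose e A : 'I_(2 ^ m) := Ordinal (enc_snap_lt A).
have ie : injective e.
  by move=> A A' /(congr1 val) /= h; rewrite -(enc_snapK A) h enc_snapK.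
have be : bijective e.
  by apply: inj_card_bij => //; rewrite card_ord -cardsT -powersetT card_powerset cardsT card_ord.
by rewrite (reindex e) //=; exact: onW_bij.
Qed.

Lemma dec_snap_window w (i : 'I_k) (e : 'I_m) :
  (e \in tnth (dec_window w) i) = bit w (i * m + e).
Proof. by rewrite tnth_mktuple finset.inE bit_div. Qed.

Definition next_code (w a : nat) : nat := w %/ 2 ^ m + a * 2 ^ ((k - 1) * m).

Lemma next_code_lt w a : w < 2 ^ (k * m) -> a < 2 ^ m -> next_code w a < 2 ^ (k * m).
Proof.
have -> : k * m = (k - 1) * m + m by nia.
rewrite expnD /next_code => hw ha.
have : w %/ 2 ^ m < 2 ^ ((k - 1) * m) by rewrite ltn_divLR ?expn_gt0.
have : a.+1 * 2 ^ ((k - 1) * m) <= 2 ^ m * 2 ^ ((k - 1) * m) by rewrite leq_mul2r ha orbT.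
rewrite mulSn; lia.
Qed.

Lemma dec_next_code w a : w < 2 ^ (k * m) ->
  dec_window (next_code w a) = push (dec_window w) (dec_snap a).
Proof.
move=> hw; apply: eq_from_tnth => i; apply/setP => e.
rewrite dec_snap_window tnth_mktuple nth_rcons size_tuple.
have [ik|] := ltnP i.+1 k.
  rewrite -[i.+1]/(val (Ordinal ik)) -tnth_nth dec_snap_window /next_code.
  rewrite bit_addM; last by have := ltn_ord e; nia.
  by rewrite bit_div mulSn addnA.
move=> ki; have iE : i.+1 = k by have := ltn_ord i; lia.
rewrite iE eqxx finset.inE -bit_div /next_code.
have -> : i = k - 1 :> nat by lia.
rewrite addnC divnMDl ?expn_gt0 // divn_small ?addn0 //.
rewrite ltn_divLR ?expn_gt0 // -expnD; congr (_ < 2 ^ _): hw; nia.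
Qed.

Lemma edge_history_dec w (e : 'I_m) :
  edge_history (dec_window w) e = [tuple bit w (i * m + e) | i < k].
Proof. by apply: eq_from_tnth => i; rewrite !tnth_mktuple -dec_snap_window tnth_mktuple. Qed.

End Codes.

Section Input.
Variables (R : realType) (k n m : nat) (M : stgraph R k n m) (s y : 'I_n).

Lemma input_prob (e : 'I_m) (w : nat) :
  rmem (input M s y) 0 (e * 2 ^ k + \sum_(i < k) bit w (i * m + e) * 2 ^ i) =
  prob M e (edge_history (dec_window k m w) e).
Proof.
rewrite /= divnMDl ?expn_gt0 // divn_small ?addn0; last first.
  exact: (bit_sum_lt (fun i => bit w (i * m + e))).
rewrite valK edge_history_dec; congr (prob M e _).
apply: eq_from_tnth => i; rewrite !tnth_mktuple.
exact: (bit_sum (fun i => bit w (i * m + e))).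
Qed.

Lemma input_init (i : 'I_k) (e : 'I_m) :
  nmem (input M s y) 3 (i * m + e) = (e \in tnth (init M) i).
Proof.
rewrite /=.
have H (T : Type) (F : T -> 'I_m -> nat) (r : seq T) x0 j : j < size r ->
    nth 0 [seq F A e0 | A <- r, e0 <- enum 'I_m] (j * m + e) = F (nth x0 r j) e.
  elim: r j => [//|A r IH] [|j] /= jr; rewrite nth_cat size_map size_enum_ord.
    by rewrite mul0n add0n ltn_ord (nth_map e) ?size_enum_ord // nth_ord_enum.
  rewrite mulSn -addnA ltnNge leq_addr /= addKn; exact: IH.
rewrite (H _ _ _ finset.set0) ?size_tuple //; by rewrite -tnth_nth.
Qed.

Lemma input_ends (e : 'I_m) :
  nmem (input M s y) 1 e = (ends (underlying M) e).1 /\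
  nmem (input M s y) 2 e = (ends (underlying M) e).2.
Proof. by split; rewrite /= (nth_map e) ?size_enum_ord // nth_ord_enum. Qed.

End Input.

(** * The program *)

Section RunE.
Variables (R : realType) (sg : memory R).
Lemma run_skip : run LSkip sg = sg. Proof. by []. Qed.
Lemma run_n a i e : run (LN a i e) sg = setn sg a (neval sg i) (neval sg e).
Proof. by []. Qed.
Lemma run_r a i e : run (LR a i e) sg = setr sg a (neval sg i) (reval sg e).
Proof. by []. Qed.
Lemma run_seq c1 c2 : run (LSeq c1 c2) sg = run c2 (run c1 sg).
Proof. by []. Qed.
Lemma run_if b c1 c2 :
  run (LIf b c1 c2) sg = if teval sg b then run c1 sg else run c2 sg.
Proof. by []. Qed.
End RunE.
Definition runE := (run_skip, run_n, run_r, run_seq, run_if).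
Global Arguments run : simpl never.
Global Arguments update T f a i x b j /.

(* Names of the natural ([a]) and real ([r]) arrays; arrays 24 and 30 to 57
   are scratch cells.  The state of vertex [v] and window code [w] has index
   [v * K + w], [aVK] and [aRow] tabulate the multiples of [K] and of the
   number of states, and [aPol] holds the current policy. *)
Local Notation aE1 := 1 (only parsing).
Local Notation aE2 := 2 (only parsing).
Local Notation aInit := 3 (only parsing).
Local Notation aVK := 4 (only parsing).
Local Notation aRow := 5 (only parsing).
Local Notation aPol := 6 (only parsing).
Local Notation a_n := 10 (only parsing).
Local Notation a_m := 11 (only parsing).
Local Notation a_k := 12 (only parsing).
Local Notation a_s := 13 (only parsing).
Local Notation a_y := 14 (only parsing).
Local Notation a_K := 15 (only parsing).
Local Notation a_N := 16 (only parsing).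
Local Notation a_2m := 17 (only parsing).
Local Notation a_2k := 18 (only parsing).
Local Notation a_H := 19 (only parsing).
Local Notation a_w0 := 20 (only parsing).
Local Notation a_P := 21 (only parsing).
Local Notation a_i0 := 22 (only parsing).
Local Notation a_has := 23 (only parsing).
Local Notation rProb := 0 (only parsing).
Local Notation rQ := 1 (only parsing).
Local Notation rC := 2 (only parsing).
Local Notation rP := 3 (only parsing).
Local Notation rF := 4 (only parsing).
Local Notation rBest := 5 (only parsing).

Definition setv (a : nat) (e : nexp) : lcmd := LN a (NConst 0) e.
Definition setrv (a : nat) (e : rexp) : lcmd := LR a (NConst 0) e.
Definition rcell (a : nat) : rexp := RGet a (NConst 0).
Definition halve (a : nat) : lcmd := setv a (NHalf (cell a)).
Definition twice (a : nat) : lcmd := setv a (NAdd (cell a) (cell a)).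
Definition todd (a : nat) : test :=
  NLe (NConst 1) (NSub (cell a) (NAdd (NHalf (cell a)) (NHalf (cell a)))).

Lemma teval_odd (R : realType) (sg : memory R) a :
  teval sg (todd a) = odd (nmem sg a 0).
Proof.
rewrite /=; set x := nmem sg a 0; have := odd_double_half x.
by case: (odd x) => /=; lia.
Qed.

Definition seqs (s : seq lcmd) : lcmd := foldr LSeq LSkip s.

Lemma run_halve_loop (R : realType) (sg : memory R) i b a :
  i != a -> b \notin [:: i; a] ->
  nmem (run (LFor i b (halve a)) sg) a 0 = nmem sg a 0 %/ 2 ^ nmem sg b 0.
Proof.
move=> ia bi; have ai : (a == i) = false by rewrite eq_sym; apply/negbTE.
apply: (@run_for_ind R (fun j sg' => nmem sg' a 0 = nmem sg a 0 %/ 2 ^ j)).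
- by rewrite /= inE ia bi.
- by rewrite /= /update ai divn1.
- move=> j sg' _ IH _ _ _; rewrite !runE /= /update ai /= !eqxx /= IH.
  by rewrite half_div_pow.
Qed.

Lemma run_twice_loop (R : realType) (sg : memory R) i b a :
  i != a -> b \notin [:: i; a] ->
  nmem (run (LFor i b (twice a)) sg) a 0 = nmem sg a 0 * 2 ^ nmem sg b 0.
Proof.
move=> ia bi; have ai : (a == i) = false by rewrite eq_sym; apply/negbTE.
apply: (@run_for_ind R (fun j sg' => nmem sg' a 0 = nmem sg a 0 * 2 ^ j)).
- by rewrite /= inE ia bi.
- by rewrite /= /update ai muln1.
- move=> j sg' _ IH _ _ _; rewrite !runE /= /update ai /= !eqxx /= IH.
  by rewrite expnS; lia.
Qed.

(* Input: window code in 34, snapshot code in 36; edge by edge, 40 and 41 hold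
   these codes shifted right, and 44 becomes the index of the edge history. *)
Definition hist_body : lcmd :=
  seqs [:: LIf (todd 45) (setv 44 (NAdd (cell 44) (cell 46))) LSkip;
           twice 46; LFor 48 a_m (halve 45)].

Definition hist_prog : lcmd :=
  seqs [:: setv 44 (cell 42); setv 45 (cell 40); setv 46 (NConst 1);
           LFor 47 a_k hist_body].

Definition prob_body : lcmd :=
  seqs [:: hist_prog;
    LIf (todd 41) (setrv rP (RMul (rcell rP) (RGet rProb (cell 44))))
      (setrv rP (RMul (rcell rP) (RSub ROne (RGet rProb (cell 44)))));
    halve 40; halve 41; setv 42 (NAdd (cell 42) (cell a_2k))].

Definition prob_prog : lcmd :=
  seqs [:: setrv rP ROne; setv 40 (cell 34); setv 41 (cell 36);
    setv 42 (NConst 0); LFor 43 a_m prob_body].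

(* Zero exactly when [a] and [b] are equal, by truncated subtraction. *)
Definition dist (a b : nexp) : nexp := NAdd (NSub a b) (NSub b a).

Lemma teval_dist (R : realType) (sg : memory R) a b a' b' :
  teval sg (NLe (NAdd (dist a b) (dist a' b')) (NConst 0)) =
  (neval sg a == neval sg b) && (neval sg a' == neval sg b').
Proof. rewrite /=; apply/idP/andP => [h|[/eqP -> /eqP ->]]; last lia. split; apply/eqP; lia. Qed.

(* Input: vertex in 37, snapshot code in 36, next window code in 35; output:
   next vertex in 38.  An illegal entry of [aPol] makes Alice stay, so every
   content of [aPol] is a legal policy. *)
Definition move_body : lcmd :=
  seqs [:: LIf (todd 49)
      (LIf (NLe (NAdd (dist (NGet aE1 (cell 50)) (cell 37))
                   (dist (NGet aE2 (cell 50)) (cell 39))) (NConst 0))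
        (setv 38 (cell 39))
        (LIf (NLe (NAdd (dist (NGet aE1 (cell 50)) (cell 39))
                   (dist (NGet aE2 (cell 50)) (cell 37))) (NConst 0))
          (setv 38 (cell 39)) LSkip)) LSkip;
    halve 49].

Definition move_prog : lcmd :=
  seqs [:: setv 38 (cell 37);
    setv 39 (NGet aPol (NAdd (NGet aVK (cell 37)) (cell 35)));
    setv 49 (cell 36); LFor 50 a_m move_body].

(** * Transition probabilities and legal moves *)

Section Subroutines.
Variables (R : realType) (k n m : nat) (M : stgraph R k n m) (s y : 'I_n).
Hypothesis k_gt0 : 0 < k.
Let K := 2 ^ (k * m).
Let N := n * K.

(** Established once by the set-up and preserved afterwards by frame reasoning. The tables stand in
    for the missing multiplication of naturals. *)
Record env (sg : memory R) : Prop := Env {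
  env_n : nmem sg a_n 0 = n; env_m : nmem sg a_m 0 = m; env_k : nmem sg a_k 0 = k;
  env_s : nmem sg a_s 0 = s; env_y : nmem sg a_y 0 = y;
  env_K : nmem sg a_K 0 = K; env_N : nmem sg a_N 0 = N;
  env_2m : nmem sg a_2m 0 = 2 ^ m; env_2k : nmem sg a_2k 0 = 2 ^ k;
  env_H : nmem sg a_H 0 = 2 ^ ((k - 1) * m);
  env_VK : forall v, v < n -> nmem sg aVK v = v * K;
  env_Row : forall i, i < N -> nmem sg aRow i = i * N;
  env_E1 : nmem sg aE1 = nmem (input M s y) aE1;
  env_E2 : nmem sg aE2 = nmem (input M s y) aE2;
  env_prob : rmem sg rProb = rmem (input M s y) rProb }.

Definition env_arrays : seq nat :=
  [:: aE1; aE2; aVK; aRow; a_n; a_m; a_k; a_s; a_y; a_K; a_N; a_2m; a_2k; a_H].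

Lemma env_frame (sg sg' : memory R) : env sg ->
  {in env_arrays, forall a, nmem sg' a = nmem sg a} ->
  rmem sg' rProb = rmem sg rProb -> env sg'.
Proof.
move=> E H H0; split; try (by rewrite ?H0 ?H //; case: E).
Qed.

Lemma env_setn (sg : memory R) a i x :
  a \notin env_arrays -> env sg -> env (setn sg a i x).
Proof.
move=> ha E; apply: (env_frame E) => // b hb; rewrite /= update_array //.
by apply: contraNneq ha => <-.
Qed.

Lemma env_setr (sg : memory R) a i x : a != rProb -> env sg -> env (setr sg a i x).
Proof. by move=> ha E; apply: (env_frame E) => //; rewrite /= update_array // eq_sym. Qed.

Lemma env_run c (sg : memory R) : all (fun a => a \notin nwrites c) env_arrays ->
  rProb \notin rwrites c -> env sg -> env (run c sg).
Proof.
move=> /allP h1 h2 E; apply: (env_frame E); last by rewrite run_rframe.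
by move=> a ha; rewrite run_nframe // h1.
Qed.

(** The bits of edge [e] in consecutive snapshots are [m] places apart in the window code, so each
    turn reads the low bit and shifts by [m]. *)
Lemma run_hist sg e W : env sg ->
  nmem sg 40 0 = W %/ 2 ^ e -> nmem sg 42 0 = e * 2 ^ k ->
  nmem (run hist_prog sg) 44 0 = e * 2 ^ k + \sum_(i < k) bit W (i * m + e) * 2 ^ i.
Proof.
move=> E h40 h42; rewrite /hist_prog /seqs /foldr run_seq run_n run_seq run_n run_seq run_n.
rewrite run_seq run_skip.
set sg1 := setn _ _ _ _.
have k1 : nmem sg1 a_k 0 = k by exact: env_k E.
pose I i (sg' : memory R) := [/\
  nmem sg' 44 0 = e * 2 ^ k + \sum_(0 <= i' < i) bit W (i' * m + e) * 2 ^ i',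
  nmem sg' 45 0 = W %/ 2 ^ (i * m + e) & nmem sg' 46 0 = 2 ^ i].
have [|||-> _ _] := @run_for_ind R I 47 a_k hist_body sg1; rewrite ?k1 //; last first.
- by rewrite big_mkord.
- move=> i sg' ik [h44 h45 h46] _ fr _.
  have m1 : nmem sg' a_m 0 = m by rewrite fr //; exact: env_m E.
  rewrite /hist_body /seqs /foldr run_seq run_if teval_odd h45.
  set sg2 := (if _ then _ else _).
  have [g44 g45 g46 gm] : [/\ nmem sg2 44 0 = nmem sg' 44 0 + bit W (i * m + e) * 2 ^ i,
    nmem sg2 45 0 = nmem sg' 45 0, nmem sg2 46 0 = nmem sg' 46 0 & nmem sg2 a_m 0 = m].
    rewrite /sg2 -/(bit W (i * m + e)); case: ifP => _; rewrite !runE /= ?h46 ?mul1n ?addn0 //.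
  clearbody sg2; rewrite run_seq run_n run_seq run_skip; set sg3 := setn _ _ _ _.
  split.
  + by rewrite [LHS]/= run_nframe // /sg3 /= g44 h44 big_nat_recr //= addnA.
  + rewrite [LHS]/= run_halve_loop // /sg3 /= g45 gm h45.
    by rewrite -divnMA -expnD; congr (_ %/ 2 ^ _); rewrite mulSn; lia.
  + by rewrite [LHS]/= run_nframe // /sg3 /= g46 h46 expnS mul2n addnn.
- by split; rewrite /= ?h42 ?h40 ?big_nil ?addn0.
Qed.

Lemma run_prob sg W A : env sg -> nmem sg 34 0 = W -> nmem sg 36 0 = A ->
  rmem (run prob_prog sg) rP 0 = step_prob M (dec_window k m W) (dec_snap m A).
Proof.
move=> E h34 h36; rewrite /prob_prog /seqs /foldr run_seq run_r run_seq run_n run_seq run_n.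
rewrite run_seq run_n run_seq run_skip.
set sg1 := setn _ _ _ _.
have E1 : env sg1 by do ?[apply: env_setn => //|apply: env_setr => //].
have m1 : nmem sg1 a_m 0 = m by exact: env_m E.
pose r e : R := rmem (input M s y) 0 (e * 2 ^ k + \sum_(i < k) bit W (i * m + e) * 2 ^ i).
pose I e (sg' : memory R) := [/\
  rmem sg' rP 0 = (\prod_(0 <= e' < e) (if bit A e' then r e' else 1 - r e'))%R,
  nmem sg' 40 0 = W %/ 2 ^ e, nmem sg' 41 0 = A %/ 2 ^ e & nmem sg' 42 0 = e * 2 ^ k].
have [|||-> _ _ _] := @run_for_ind R I 43 a_m prob_body sg1; rewrite ?m1 //; last first.
- rewrite big_mkord; apply: eq_bigr => e _.
  by rewrite finset.inE /r input_prob.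
- move=> e sg' em [hP h40 h41 h42] _ fr frr.
  have E' : env sg'.
    apply: env_frame E1 _ _; last by rewrite frr.
    by move=> a ha; rewrite fr //; move: a ha; apply/allP.
  have h44 := run_hist E' h40 h42.
  rewrite /prob_body /seqs /foldr run_seq.
  have [f1 f2] := (@run_nframe R hist_prog sg', @run_rframe R hist_prog sg').
  set sg2 := run hist_prog sg' in h44 f1 f2 *; clearbody sg2.
  have pr : rmem sg2 rProb = rmem (input M s y) 0 by rewrite f2 // (env_prob E').
  rewrite run_seq run_if teval_odd.
  set sg3 := (if _ then _ else _).
  have [g1 g2] : rmem sg3 rP 0 = (\prod_(0 <= e' < e.+1) (if bit A e' then r e' else 1 - r e'))%R
     /\ nmem sg3 = nmem sg2.
    rewrite /sg3 f1 // h41 -/(bit A e); case: ifP => bA; rewrite !runE; split=> //.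
      by rewrite /= big_nat_recr //= bA h44 pr f2 // hP.
    by rewrite /= big_nat_recr //= bA h44 pr f2 // hP.
  clearbody sg3; rewrite !runE.
  split; rewrite /= ?g2.
  + exact: g1.
  + by rewrite f1 // h40 half_div_pow.
  + by rewrite f1 // h41 half_div_pow.
  + by rewrite !f1 // h42 (env_2k E') mulSn addnC.
- by split; rewrite /= ?big_nil ?h34 ?h36 ?divn1.
Qed.

Lemma run_move sg (v t : 'I_n) A w' : env sg ->
  nmem sg 37 0 = v -> nmem sg 36 0 = A -> nmem sg 35 0 = w' ->
  nmem sg aPol (v * K + w') = t ->
  nmem (run move_prog sg) 38 0 =
  (if move_ok M (dec_snap m A) v t then t else v).
Proof.
move=> E h37 h36 h35 ht; rewrite /move_prog /seqs /foldr run_seq run_n run_seq run_n run_seq run_n.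
rewrite run_seq run_skip.
set sg1 := setn _ _ _ _.
have m1 : nmem sg1 a_m 0 = m by exact: env_m E.
have g39 : nmem sg1 39 0 = t by rewrite /= h37 h35 (env_VK E).
have g37 : nmem sg1 37 0 = v by [].
(* The case [t == v] belongs here because cell 38 starts at [v], which is then already the
   target. *)
pose I e (sg' : memory R) := nmem sg' 49 0 = A %/ 2 ^ e /\
  nmem sg' 38 0 = if (t == v) || [exists e' : 'I_m, [&& e' < e, e' \in dec_snap m A &
    (ends (underlying M) e' == (v, t)) || (ends (underlying M) e' == (t, v))]]
    then t else v.
have [|||_ ->] := @run_for_ind R I 50 a_m move_body sg1; rewrite ?m1 //; last first.
- by under eq_existsb do rewrite ltn_ord.
- move=> e sg' em [h49 h38] h50 fr _.
  pose e1 := Ordinal em.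
  have [i1 i2] := input_ends M s y e1.
  rewrite /move_body /seqs /foldr run_seq run_if teval_odd h49.
  set sg2 := (if _ then _ else _).
  have [g49 g38] : nmem sg2 49 0 = nmem sg' 49 0 /\
     nmem sg2 38 0 = if [&& e1 \in dec_snap m A &
       (ends (underlying M) e1 == (v, t)) || (ends (underlying M) e1 == (t, v))]
       then (t : nat) else nmem sg' 38 0.
    have F1 : nmem sg' 1 e = (ends (underlying M) e1).1.
      by rewrite fr // -i1 /= (env_E1 E).
    have F2 : nmem sg' 2 e = (ends (underlying M) e1).2.
      by rewrite fr // -i2 /= (env_E2 E).
    have F3 : nmem sg' 37 0 = v by rewrite fr.
    have F4 : nmem sg' 39 0 = t by rewrite fr.
    rewrite /sg2 finset.inE -/(bit A e); case: ifP => bA; last by rewrite run_skip.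
    rewrite run_if teval_dist run_if teval_dist.
    rewrite /= h50 F1 F2 F3 F4 !runE /= F4.
    rewrite [ends _ _]surjective_pairing !xpair_eqE -!val_eqE /=.
    by case: (_ && _) => //=; case: (_ && _).
  clearbody sg2; rewrite !runE /I /= g49 h49 g38 h38 half_div_pow; split=> //.
  pose p e' := (e' \in dec_snap m A) &&
    ((ends (underlying M) e' == (v, t)) || (ends (underlying M) e' == (t, v))).
  have -> : [exists e' : 'I_m, (e' < e.+1) && p e'] =
      [exists e' : 'I_m, (e' < e) && p e'] || p e1.
    apply/existsP/orP => [[e' /andP[]]|].
      rewrite ltnS leq_eqVlt => /orP[/eqP ee|ee] p1.
        by right; rewrite (_ : e1 = e') //; apply: val_inj.
      by left; apply/existsP; exists e'; rewrite ee p1.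
    case=> [/existsP[e' /andP[p1 p2]]|p1]; last by exists e1; rewrite p1 /= leqnn.
    by exists e'; rewrite p2 ltnS ltnW.
  by rewrite -/(p e1) orbA; case: (_ || _); case: (p e1).
- split; first by rewrite /= divn1.
  rewrite /= h37; case: (eqVneq t v) => [->//|_] /=.
  by case: existsP => [[e' //]|//].
Qed.

End Subroutines.

(** * Assembling and eliminating the system of one policy *)

Definition qidx (i l : nexp) : nexp := NAdd (NGet aRow i) l.
Definition qget (i l : nat) : rexp := RGet rQ (qidx (cell i) (cell l)).
Definition qset (i l : nat) (e : rexp) : lcmd := LR rQ (qidx (cell i) (cell l)) e.

Definition clear_prog : lcmd :=
  LFor 30 a_N (seqs [:: LR rC (cell 30) ROne; LFor 31 a_N (qset 30 31 RZero)]).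

Definition entry_idx : nexp :=
  qidx (NAdd (NGet aVK (cell 37)) (cell 34)) (NAdd (NGet aVK (cell 38)) (cell 35)).

Definition vertex_body : lcmd :=
  seqs [:: move_prog;
    LIf (NLe (NAdd (dist (cell 38) (cell a_y)) (dist (NConst 0) (NConst 0))) (NConst 0))
      LSkip (LR rQ entry_idx (RAdd (RGet rQ entry_idx) (rcell rP)))].

Definition snap_body : lcmd :=
  seqs [:: prob_prog; LFor 37 a_n vertex_body; setv 35 (NAdd (cell 35) (cell a_H))].

Definition window_body : lcmd :=
  seqs [:: setv 35 (cell 34); LFor 30 a_m (halve 35); LFor 36 a_2m snap_body].

Definition build_prog : lcmd := LFor 34 a_K window_body.

Definition row_body : lcmd :=
  seqs [:: setrv rF (qget 53 51); qset 53 51 RZero;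
    LR rC (cell 53) (RAdd (RGet rC (cell 53)) (RMul (rcell rF) (RGet rC (cell 51))));
    LFor 52 a_N (qset 53 52 (RAdd (qget 53 52) (RMul (rcell rF) (qget 51 52))))].

(* If [1 <= Q j j] then [x j = +oo], because the constant terms are positive;
   column [j] is kept and marks the rows with an infinite solution. *)
Definition elim_body : lcmd :=
  LIf (RLe ROne (qget 51 51)) LSkip
    (seqs [:: setrv rF (RDiv ROne (RSub ROne (qget 51 51))); qset 51 51 RZero;
       LR rC (cell 51) (RMul (RGet rC (cell 51)) (rcell rF));
       LFor 52 a_N (qset 51 52 (RMul (qget 51 52) (rcell rF)));
       LFor 53 a_N row_body]).

Definition elim_prog : lcmd := LFor 51 a_N elim_body.

Lemma idx_eq (N i i' l l' : nat) : l < N -> l' < N ->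
  (i * N + l == i' * N + l') = (i == i') && (l == l').
Proof.
move=> lN l'N; apply/eqP/andP => [h|[/eqP -> /eqP ->] //].
have N0 : 0 < N by exact: leq_ltn_trans lN.
have := congr1 (modn^~ N) h; rewrite !modnMDl !modn_small // => e.
have := congr1 (divn^~ N) h; rewrite !divnMDl // !divn_small // !addn0 => e'.
by rewrite e e' !eqxx.
Qed.

Section Evaluation.
Variables (R : realType) (k n m : nat) (M : stgraph R k n m) (s y : 'I_n).
Hypothesis k_gt0 : 0 < k.
Let K := 2 ^ (k * m).
Let N := n * K.
Notation env := (env M s y).

Definition Qv (sg : memory R) i l : R := rmem sg rQ (i * N + l).
Definition Cv (sg : memory R) i : R := rmem sg rC i.
Local Arguments Qv : simpl never.
Local Arguments Cv : simpl never.

Lemma env_qidx sg i l : env sg -> neval sg i < N ->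
  neval sg (qidx i l) = neval sg i * N + neval sg l.
Proof. by move=> E iN; rewrite /= (env_Row E). Qed.

Lemma Qv_setr sg i l i0 l0 x : l < N -> l0 < N ->
  Qv (setr sg rQ (i0 * N + l0) x) i l =
  if (i == i0) && (l == l0) then x else Qv sg i l.
Proof. by move=> lN l0N; rewrite /Qv /= idx_eq. Qed.

Lemma run_qset sg i l e : env sg -> nmem sg i 0 < N ->
  run (qset i l e) sg = setr sg rQ (nmem sg i 0 * N + nmem sg l 0) (reval sg e).
Proof. by move=> E iN; rewrite /qset run_r env_qidx. Qed.

Lemma reval_qget sg i l : env sg -> nmem sg i 0 < N ->
  reval sg (qget i l) = Qv sg (nmem sg i 0) (nmem sg l 0).
Proof. by move=> E iN; rewrite /qget /Qv /= (env_Row E). Qed.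

Lemma run_clear sg : env sg ->
  (forall i, i < N -> Cv (run clear_prog sg) i = 1%R) /\
  (forall i l, i < N -> l < N -> Qv (run clear_prog sg) i l = 0%R).
Proof.
move=> E; rewrite /clear_prog.
pose I q (sg' : memory R) := (forall i, i < q -> Cv sg' i = 1%R) /\
  (forall i l, i < q -> l < N -> Qv sg' i l = 0%R).
have n1 : nmem sg a_N 0 = N by exact: env_N E.
suff: I N (run clear_prog sg) by [].
rewrite -{1}n1; apply: (@run_for_ind R I) => //.
move=> q sg'; rewrite n1 => qN [hC hQ] h30 fr frr.
have E' : env sg'.
  by apply: (env_frame E); [move=> a ha; rewrite fr //; move: a ha; exact/allP|rewrite frr].
rewrite /seqs /foldr run_seq run_r run_seq run_skip.
set sg1 := setr _ _ _ _.
have E1 : env sg1 by exact: env_setr.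
have N1 : nmem sg1 a_N 0 = N by exact: env_N E1.
pose J q' (sg' : memory R) := forall i l, i <= q -> l < N ->
  (i < q) || (l < q') -> Qv sg' i l = 0%R.
have HJ : J N (run (LFor 31 a_N (qset 30 31 RZero)) sg1).
  rewrite -{1}N1; apply: (@run_for_ind R J) => //.
    by move=> i l iq lN; rewrite orbF => h; exact: hQ.
  move=> q' sg2; rewrite N1 => q'N H2 h31 fr2 frr2.
  have E2 : env sg2.
    by apply: (env_frame E1); [move=> a ha; rewrite fr2 //; move: a ha; exact/allP|rewrite frr2].
  have h30' : nmem sg2 30 0 = q by rewrite fr2.
  move=> i l iq lN h; rewrite run_qset ?h30' ?h31 // /=.
  rewrite [LHS](_ : _ = Qv (setr sg2 rQ (q * N + q') 0%R) i l) // Qv_setr //.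
  case: ifP => // /negbT; rewrite negb_and => h'; apply: H2 => //; move: h h'; lia.
split=> [i|i l]; rewrite ltnS => iq.
  rewrite /Cv /= run_rframe // /sg1 /= h30; case: eqP => // /eqP ne; apply: hC.
  by rewrite ltn_neqAle ne iq.
by move=> lN; apply: HJ => //; rewrite lN orbT.
Qed.

Variable f : nat -> nat.
Hypothesis f_lt : forall z, z < N -> f z < n.

Definition choice_at (w' a : nat) (v : 'I_n) : 'I_n :=
  let t := insubd v (f (v * K + w')) in
  if move_ok M (dec_snap m a) v t then t else v.

Definition prob_at w a : R := step_prob M (dec_window k m w) (dec_snap m a).

(** The summand of [backup] for snapshot code [a], with a vector [x] in place of a value
    function. *)
Definition entry_at (x : nat -> R) w a (v : 'I_n) : R :=
  let u := choice_at (next_code k m w a) a v in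
  if u == y then 0%R else (prob_at w a * x (u * K + next_code k m w a)%N)%R.

(* All that is used of the matrix is its non-negativity and these sums for an
   arbitrary [x], so entries hit several times need no bookkeeping. *)
Definition rowsum (sg : memory R) (x : nat -> R) i : R := (\sum_(l < N) Qv sg i l * x l)%R.

Definition nonneg_mx (sg : memory R) := forall i l, i < N -> l < N -> (0 <= Qv sg i l)%R.

Lemma state_lt (v : 'I_n) w : w < K -> v * K + w < N.
Proof.
move=> wK; apply: (@leq_trans (v.+1 * K)); first by rewrite mulSn addnC ltn_add2r.
by rewrite leq_mul2r ltn_ord orbT.
Qed.

Lemma rowsum_setr sg x i i0 l0 p : l0 < N ->
  rowsum (setr sg rQ (i0 * N + l0) (Qv sg i0 l0 + p)%R) x i =
  (rowsum sg x i + (if i == i0 then p * x l0 else 0))%R.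
Proof.
move=> l0N; rewrite /rowsum (bigD1 (Ordinal l0N)) //= [in RHS](bigD1 (Ordinal l0N)) //=.
rewrite Qv_setr // eqxx andbT; case: eqP => [->|_].
  rewrite mulrDl -!addrA; congr (_ + _)%R; rewrite addrC; congr (_ + _)%R.
  by apply: eq_bigr => l ll; rewrite Qv_setr // eqxx /= ifN.
rewrite addr0; congr (_ + _)%R; apply: eq_bigr => l ll; rewrite Qv_setr //.
rewrite ifN // negb_and; apply/orP; right.
by apply: contra ll => /eqP h; apply/eqP/val_inj.
Qed.

Lemma run_vertex sg (v : 'I_n) w a : env sg -> nmem sg aPol = f -> w < K -> a < 2 ^ m ->
  nmem sg 37 0 = v -> nmem sg 34 0 = w -> nmem sg 36 0 = a ->
  nmem sg 35 0 = next_code k m w a -> rmem sg rP 0 = prob_at w a ->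
  nonneg_mx sg ->
  nonneg_mx (run vertex_body sg) /\
  forall x i, rowsum (run vertex_body sg) x i =
    (rowsum sg x i + (if i == (v * K + w)%N then entry_at x w a v else 0))%R.
Proof.
move=> E hf wK am h37 h34 h36 h35 hp nn.
have w'K := next_code_lt k_gt0 wK am.
have ht : nmem sg aPol (v * K + next_code k m w a) =
    insubd v (f (v * K + next_code k m w a)).
  by rewrite hf insubdK // -topredE /= f_lt // state_lt.
have hu := run_move E h37 h36 h35 ht.
rewrite /vertex_body /seqs /foldr run_seq run_seq run_skip.
have f1 := @run_nframe R move_prog sg; have f2 := @run_rframe R move_prog sg.
have E1 : env (run move_prog sg) by apply: env_run.
set sg1 := run move_prog sg in hu f1 f2 E1 *; clearbody sg1.
have {}hu : nmem sg1 38 0 = choice_at (next_code k m w a) a v by [].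
rewrite run_if teval_dist /= hu (env_y E1) andbT val_eqE.
have Q1 i l : Qv sg1 i l = Qv sg i l by rewrite /Qv f2.
have R1 x i : rowsum sg1 x i = rowsum sg x i.
  by apply: eq_bigr => l _; rewrite Q1.
rewrite /entry_at; case: eqP => _.
  rewrite run_skip; split=> [i l iN lN|x i]; first by rewrite Q1 nn.
  by rewrite R1; case: ifP; rewrite addr0.
rewrite run_r.
set u := choice_at _ _ _ in hu *.
have i0E : neval sg1 entry_idx = (v * K + w) * N + (u * K + next_code k m w a).
  by rewrite /= hu !f1 // h37 h34 h35 !(env_VK E) ?(env_Row E) ?state_lt.
have l0N := state_lt u w'K.
have -> : reval sg1 (RAdd (RGet rQ entry_idx) (rcell rP)) =
    (Qv sg1 (v * K + w) (u * K + next_code k m w a) + prob_at w a)%R.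
  rewrite -[LHS]/(rmem sg1 rQ (neval sg1 entry_idx) + rmem sg1 rP 0)%R i0E.
  by rewrite (f2 rP) // hp.
rewrite i0E; split=> [i l iN lN|x i]; last by rewrite rowsum_setr // R1.
rewrite Qv_setr //; case: ifP => _; last by rewrite Q1 nn.
apply: addr_ge0; last exact: step_prob_ge0.
by rewrite Q1 nn ?state_lt.
Qed.

Lemma run_snap sg w a : env sg -> nmem sg aPol = f -> w < K -> a < 2 ^ m ->
  nmem sg 34 0 = w -> nmem sg 36 0 = a -> nmem sg 35 0 = next_code k m w a ->
  nonneg_mx sg ->
  let sg' := run snap_body sg in
  [/\ nonneg_mx sg', nmem sg' 35 0 = next_code k m w a.+1 &
  forall x (v : 'I_n) w1, w1 < K -> rowsum sg' x (v * K + w1) =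
    (rowsum sg x (v * K + w1) + (if w1 == w then entry_at x w a v else 0))%R].
Proof.
move=> E hf wK am h34 h36 h35 nn.
have hp := run_prob k_gt0 E h34 h36.
rewrite /snap_body /seqs /foldr run_seq run_seq run_seq run_skip run_n.
have f1 := @run_nframe R prob_prog sg; have f2 := @run_rframe R prob_prog sg.
have E1 : env (run prob_prog sg) by apply: env_run.
set sg1 := run prob_prog sg in hp f1 f2 E1 *; clearbody sg1.
have n1 : nmem sg1 a_n 0 = n by exact: env_n E1.
pose I q (sg' : memory R) := nonneg_mx sg' /\
  forall x (v : 'I_n) w1, w1 < K -> rowsum sg' x (v * K + w1) =
    (rowsum sg x (v * K + w1) + (if (w1 == w) && (v < q)%N then entry_at x w a v else 0))%R.
have [] : I n (run (LFor 37 a_n vertex_body) sg1).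
  rewrite -{1}n1; apply: (@run_for_ind R I) => //.
    split=> [i l iN lN|x v w1 w1K]; first by rewrite /Qv /= f2 // nn.
    rewrite ltn0 andbF addr0; apply: eq_bigr => l _; by rewrite /Qv /= f2.
  move=> q sg2; rewrite n1 => qn [nn2 H2] h37 fr frr.
  have E2 : env sg2.
    by apply: (env_frame E1); [move=> b hb; rewrite fr //; move: b hb; exact/allP|rewrite frr].
  have [|||||nn3 H3] := @run_vertex sg2 (Ordinal qn) w a E2 _ wK am h37 _ _ _ _ nn2;
    rewrite ?fr ?f1 ?frr //.
  split=> [i l iN lN|x v w1 w1K]; first exact: nn3.
  transitivity (rowsum (run vertex_body sg2) x (v * K + w1)); first by [].
  rewrite H3 H2 // -addrA; congr (_ + _)%R.
  rewrite idx_eq //= ltnS [v <= q]leq_eqVlt.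
  case: (eqVneq (v : nat) q) => [vq|vq]; last by rewrite addr0.
  rewrite vq ltnn andbF add0r andbT (_ : Ordinal qn = v) //; exact: val_inj.
have f3 := @run_nframe R (LFor 37 a_n vertex_body) sg1.
set sg2 := run _ _ in f3 *; clearbody sg2 => nn2 H2; split=> //.
(* The next snapshot code raises the window code by [2 ^ ((k - 1) * m)], the content of [a_H]. *)
- rewrite /= !f3 // f1 // h35 (env_H E1) /next_code mulSn; lia.
- move=> x v w1 w1K; transitivity (rowsum sg2 x (v * K + w1)); first by [].
  by rewrite H2 // ltn_ord andbT.
Qed.

Lemma run_window sg w : env sg -> nmem sg aPol = f -> w < K -> nmem sg 34 0 = w ->
  nonneg_mx sg ->
  let sg' := run window_body sg in
  nonneg_mx sg' /\
  forall x (v : 'I_n) w1, w1 < K -> rowsum sg' x (v * K + w1) =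
    (rowsum sg x (v * K + w1) +
     (if w1 == w then \sum_(a < 2 ^ m) entry_at x w a v else 0))%R.
Proof.
move=> E hf wK h34 nn; rewrite /window_body /seqs /foldr run_seq run_n run_seq run_seq run_skip.
set sg0 := setn _ _ _ _.
have E0' : env sg0 by exact: env_setn.
(* Dropping the oldest snapshot already gives the next window code for the empty snapshot. *)
have h35 : nmem (run (LFor 30 a_m (halve 35)) sg0) 35 0 = next_code k m w 0.
  by rewrite run_halve_loop // (env_m E0') /= h34 /next_code mul0n addn0.
have f1 := @run_nframe R (LFor 30 a_m (halve 35)) sg0.
have f2 := @run_rframe R (LFor 30 a_m (halve 35)) sg0.
have E1 : env (run (LFor 30 a_m (halve 35)) sg0) by apply: env_run.
set sg1 := run _ sg0 in h35 f1 f2 E1 *; clearbody sg1.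
have n1 : nmem sg1 a_2m 0 = 2 ^ m by exact: env_2m E1.
pose I q (sg' : memory R) := [/\ nonneg_mx sg', nmem sg' 35 0 = next_code k m w q &
  forall x (v : 'I_n) w1, w1 < K -> rowsum sg' x (v * K + w1) =
    (rowsum sg x (v * K + w1) +
     (if w1 == w then \sum_(0 <= a < q) entry_at x w a v else 0))%R].
have [] : I (2 ^ m) (run (LFor 36 a_2m snap_body) sg1).
  rewrite -{1}n1; apply: (@run_for_ind R I) => //.
    split=> [i l iN lN||x v w1 w1K]; [by rewrite /Qv /= f2 // nn|by []|].
    rewrite big_nil if_same addr0; apply: eq_bigr => l _; by rewrite /Qv /= f2.
  move=> q sg2; rewrite n1 => qm [nn2 h35' H2] h36 fr frr.
  have E2 : env sg2.
    by apply: (env_frame E1); [move=> b hb; rewrite fr //; move: b hb; exact/allP|rewrite frr].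
  have [||nn3 h35'' H3] := @run_snap sg2 w q E2 _ wK qm _ h36 h35' nn2; rewrite ?fr ?f1 //.
  split=> [i l iN lN||x v w1 w1K]; [exact: nn3|exact: h35''|].
  transitivity (rowsum (run snap_body sg2) x (v * K + w1)); first by [].
  rewrite H3 // H2 // -addrA; congr (_ + _)%R.
  by case: eqP => _; rewrite ?addr0 // big_nat_recr.
set sg2 := run _ _; move=> nn2 _ H2; split=> // x v w1 w1K.
by rewrite H2 // big_mkord.
Qed.

Lemma run_build sg : env sg -> nmem sg aPol = f -> nonneg_mx sg ->
  let sg' := run build_prog sg in
  nonneg_mx sg' /\
  forall x (v : 'I_n) w, w < K -> rowsum sg' x (v * K + w) =
    (rowsum sg x (v * K + w) + \sum_(a < 2 ^ m) entry_at x w a v)%R.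
Proof.
move=> E hf nn /=.
pose I q (sg' : memory R) := nonneg_mx sg' /\
  forall x (v : 'I_n) w1, w1 < K -> rowsum sg' x (v * K + w1) =
    (rowsum sg x (v * K + w1) +
     (if (w1 < q)%N then \sum_(a < 2 ^ m) entry_at x w1 a v else 0))%R.
have n1 : nmem sg a_K 0 = K by exact: env_K E.
have [nn2 H2] : I K (run build_prog sg).
  rewrite -{1}n1; apply: (@run_for_ind R I) => //.
    by split=> [i l iN lN|x v w1 w1K]; [exact: nn|rewrite addr0].
  move=> q sg2; rewrite n1 => qm [nn2 H2] h34 fr frr.
  have E2 : env sg2.
    by apply: (env_frame E); [move=> b hb; rewrite fr //; move: b hb; exact/allP|rewrite frr].
  have [|nn3 H3] := @run_window sg2 q E2 _ qm h34 nn2; rewrite ?fr //.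
  split=> [i l iN lN|x v w1 w1K]; first exact: nn3.
  transitivity (rowsum (run window_body sg2) x (v * K + w1)); first by [].
  rewrite H3 // H2 // -addrA; congr (_ + _)%R.
  rewrite ltnS [w1 <= q]leq_eqVlt; case: (eqVneq w1 q) => [->|_]; last by rewrite addr0.
  by rewrite ltnn add0r.
by split=> // x v w1 w1K; rewrite H2 // w1K.
Qed.

(** The loop over rows also visits the pivot row. This is harmless: its diagonal entry has been set
    to 0, so the multiplier is 0. *)
Lemma run_row sg i j : env sg -> i < N -> j < N ->
  nmem sg 53 0 = i -> nmem sg 51 0 = j ->
  let sg' := run row_body sg in
  (forall i', Cv sg' i' = if i' == i then (Cv sg i + Qv sg i j * Cv sg j)%R else Cv sg i') /\
  (i = j -> Qv sg j j = 0%R -> forall i' l, l < N -> Qv sg' i' l = Qv sg i' l) /\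
  (i != j -> forall i' l, l < N -> Qv sg' i' l =
     if i' == i then ((if l == j then 0 else Qv sg i l) + Qv sg i j * Qv sg j l)%R
     else Qv sg i' l).
Proof.
move=> E iN jN h53 h51; rewrite /row_body /seqs /foldr run_seq run_r run_seq.
set sg1 := setr _ _ _ _.
have [E1 n1 F1 Q1 C1] : [/\ env sg1, nmem sg1 = nmem sg, rmem sg1 rF 0 = Qv sg i j,
    rmem sg1 rQ = rmem sg rQ & rmem sg1 rC = rmem sg rC].
  by split=> //; [exact: env_setr|rewrite /sg1 -{1}h53 -h51 -reval_qget ?h53].
clearbody sg1; rewrite run_qset ?n1 ?h53 // [reval _ RZero]/= h51.
set sg2 := setr _ _ _ _.
have [E2 n2 F2 C2] : [/\ env sg2, nmem sg2 = nmem sg, rmem sg2 rF 0 = Qv sg i j &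
    rmem sg2 rC = rmem sg rC].
  by split=> //; exact: env_setr.
have Q2 i' l : l < N -> Qv sg2 i' l = if (i' == i) && (l == j) then 0%R else Qv sg i' l.
  by move=> lN; rewrite Qv_setr // /Qv Q1.
clearbody sg2; clear sg1 E1 n1 F1 Q1 C1.
rewrite run_seq run_r run_seq run_skip.
set sg3 := setr _ _ _ _.
have E3 : env sg3 by exact: env_setr.
have F3 : rmem sg3 rF 0 = Qv sg i j by [].
have C3 i' : Cv sg3 i' = if i' == i then (Cv sg i + Qv sg i j * Cv sg j)%R else Cv sg i'.
  by rewrite /sg3 /Cv /= F2 C2 n2 h53 h51.
have Q3 i' l : l < N -> Qv sg3 i' l = if (i' == i) && (l == j) then 0%R else Qv sg i' l.
  by move=> lN; rewrite -Q2.
have n3 : nmem sg3 a_N 0 = N by exact: env_N E3.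
have [g53 g51] : nmem sg3 53 0 = i /\ nmem sg3 51 0 = j by rewrite /= n2.
clearbody sg3; clear sg2 E2 n2 F2 C2 Q2.
pose I q (sg' : memory R) := forall i' l, l < N -> Qv sg' i' l =
  if (i' == i) && (l < q) then (Qv sg3 i l + Qv sg i j * Qv sg3 j l)%R else Qv sg3 i' l.
set c := LFor _ _ _.
have H : I N (run c sg3).
  rewrite -{1}n3; apply: (@run_for_ind R I) => //.
    by move=> i' l lN; rewrite ltn0 andbF.
  move=> q sg4; rewrite n3 => qN H4 h52 fr frr.
  have E4 : env sg4.
    by apply: (env_frame E3); [move=> b hb; rewrite fr //; move: b hb; exact/allP|rewrite frr].
  have i4 : nmem sg4 53 0 = i by rewrite fr.
  have j4 : nmem sg4 51 0 = j by rewrite fr.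
  move=> i' l lN; rewrite run_qset ?i4 // h52 -[LHS]/(Qv (setr _ _ _ _) i' l) Qv_setr // H4 //.
  have -> : reval sg4 (RAdd (qget 53 52) (RMul (rcell rF) (qget 51 52))) =
      (Qv sg4 i q + rmem sg4 rF 0 * Qv sg4 j q)%R.
    by rewrite -i4 -j4 -h52 -!reval_qget // ?i4 ?j4.
  rewrite !H4 // ltnn !andbF frr // F3 ltnS [l <= q]leq_eqVlt.
  case: (eqVneq i' i) => [->|//] /=; case: (eqVneq l q) => [->//|_] //=.
have fC : rmem (run c sg3) rC = rmem sg3 rC by rewrite run_rframe.
split=> [i'|]; first by rewrite -C3 /Cv fC.
split=> [ij qj0 i' l lN|ij i' l lN]; rewrite H // lN andbT !Q3 // ?jN.
  rewrite ij qj0 mul0r addr0 eqxx /=.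
  by case: (eqVneq i' j) => [->|//] /=; case: eqP => [->|].
rewrite eqxx (negbTE (_ : j != i)) 1?eq_sym //=.
by case: eqP.
Qed.

Lemma run_elim_body sg j : env sg -> j < N -> nmem sg 51 0 = j ->
  let sg' := run elim_body sg in
  (forall i l, i < N -> l < N -> Qv sg' i l = elim_mx j (Qv sg) i l) /\
  (forall i, i < N -> Cv sg' i = elim_rhs j (Qv sg) (Cv sg) i).
Proof.
move=> E jN h51; rewrite /elim_body run_if.
have tE : teval sg (RLe ROne (qget 51 51)) = (1 <= Qv sg j j)%R.
  by rewrite -h51 -reval_qget ?h51.
rewrite tE /elim_mx /elim_rhs; case: ifP => _; first by rewrite run_skip.
rewrite /seqs /foldr run_seq run_r run_seq.
(* The factor is saved before the diagonal entry is overwritten with 0. *)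
set fv : R := (1 / (1 - Qv sg j j))%R.
have -> : reval sg (RDiv ROne (RSub ROne (qget 51 51))) = fv.
  by rewrite /fv -h51 -reval_qget ?h51.
set sg1 := setr _ _ _ _.
have [E1 n1 F1 Q1 C1] : [/\ env sg1, nmem sg1 = nmem sg, rmem sg1 rF 0 = fv,
    rmem sg1 rQ = rmem sg rQ & rmem sg1 rC = rmem sg rC].
  by split=> //; exact: env_setr.
clearbody sg1; rewrite run_qset ?n1 ?h51 // [reval _ RZero]/=.
set sg2 := setr _ _ _ _.
have [E2 n2 F2 C2] : [/\ env sg2, nmem sg2 = nmem sg, rmem sg2 rF 0 = fv &
    rmem sg2 rC = rmem sg rC].
  by split=> //; exact: env_setr.
have Q2 i l : l < N -> Qv sg2 i l = if (i == j) && (l == j) then 0%R else Qv sg i l.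
  by move=> lN; rewrite Qv_setr // /Qv Q1.
clearbody sg2; clear sg1 E1 n1 F1 Q1 C1.
rewrite run_seq run_r run_seq run_seq run_skip.
set sg3 := setr _ _ _ _.
have E3 : env sg3 by exact: env_setr.
have F3 : rmem sg3 rF 0 = fv by [].
have C3 i : Cv sg3 i = if i == j then (Cv sg j * fv)%R else Cv sg i.
  by rewrite /sg3 /Cv /= F2 C2 n2 h51.
have Q3 i l : l < N -> Qv sg3 i l = if (i == j) && (l == j) then 0%R else Qv sg i l.
  by move=> lN; rewrite -Q2.
have n3 : nmem sg3 a_N 0 = N by exact: env_N E3.
have g51 : nmem sg3 51 0 = j by rewrite /= n2.
clearbody sg3; clear sg2 E2 n2 F2 C2 Q2.
set c1 := LFor 52 _ _.
pose I q (sg' : memory R) := forall i l, l < N -> Qv sg' i l =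
  if (i == j) && (l < q) then (Qv sg3 j l * fv)%R else Qv sg3 i l.
have H : I N (run c1 sg3).
  rewrite -{1}n3; apply: (@run_for_ind R I) => //.
    by move=> i' l lN; rewrite ltn0 andbF.
  move=> q sg4; rewrite n3 => qN H4 h52 fr frr.
  have E4 : env sg4.
    by apply: (env_frame E3); [move=> b hb; rewrite fr //; move: b hb; exact/allP|rewrite frr].
  have j4 : nmem sg4 51 0 = j by rewrite fr.
  move=> i l lN; rewrite run_qset ?j4 // h52 -[LHS]/(Qv (setr _ _ _ _) i l) Qv_setr // H4 //.
  have -> : reval sg4 (RMul (qget 51 52) (rcell rF)) = (Qv sg4 j q * rmem sg4 rF 0)%R.
    by rewrite -j4 -h52 -!reval_qget // ?j4.
  rewrite !H4 // ltnn !andbF frr // F3 ltnS [l <= q]leq_eqVlt.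
  case: (eqVneq i j) => [->|//] /=; case: (eqVneq l q) => [->//|_] //=.
have f4 := @run_nframe R c1 sg3; have g4 := @run_rframe R c1 sg3.
have E4 : env (run c1 sg3) by apply: env_run.
set sg4 := run c1 sg3 in H f4 g4 E4 *; clearbody sg4.
have Q4 i l : l < N -> Qv sg4 i l = if i == j then pivot_row j (Qv sg) l else Qv sg i l.
  move=> lN; rewrite H // lN andbT /pivot_row !Q3 //.
  case: (eqVneq i j) => [_|//] /=; case: (eqVneq l j) => [_|_]; rewrite eqxx /= ?mul0r //.
  by rewrite /fv div1r.
have C4 i : Cv sg4 i = if i == j then (Cv sg j / (1 - Qv sg j j))%R else Cv sg i.
  by rewrite /Cv g4 // [LHS]C3 /fv div1r.
have Qjj : Qv sg4 j j = 0%R by rewrite Q4 // eqxx /pivot_row eqxx.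
have n4 : nmem sg4 a_N 0 = N by exact: env_N E4.
have g51' : nmem sg4 51 0 = j by rewrite f4.
clear sg3 E3 F3 C3 Q3 n3 g51 I H f4 g4 c1.
pose I q (sg' : memory R) := (forall i l, i < N -> l < N -> Qv sg' i l =
    if (i < q) && (i != j) then ((if l == j then 0 else Qv sg4 i l) + Qv sg4 i j * Qv sg4 j l)%R
    else Qv sg4 i l) /\
  (forall i, Cv sg' i = if (i < q) && (i != j) then (Cv sg4 i + Qv sg4 i j * Cv sg4 j)%R
    else Cv sg4 i).
have [HQ HC] : I N (run (LFor 53 a_N row_body) sg4).
  rewrite -{1}n4; apply: (@run_for_ind R I) => //.
  move=> q sg5; rewrite n4 => qN [H5 D5] h53 fr frr.
  have E5 : env sg5.
    by apply: (env_frame E4); [move=> b hb; rewrite fr //; move: b hb; exact/allP|rewrite frr].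
  have j5 : nmem sg5 51 0 = j by rewrite fr.
  have [K1 [K2 K3]] := run_row E5 qN jN h53 j5.
  have Qj l : l < N -> Qv sg5 j l = Qv sg4 j l.
    by move=> lN; rewrite H5 // eqxx andbF.
  split=> [i l iN lN|i].
    rewrite -[LHS]/(Qv (run row_body sg5) i l).
    case: (eqVneq q j) => [qj|qj].
      rewrite K2 // ?Qj // H5 // ltnS [i <= q]leq_eqVlt.
      by case: (eqVneq i q) => [->|//]; rewrite qj eqxx !andbF.
    rewrite K3 //; case: (eqVneq i q) => [->|iq]; last first.
      by rewrite H5 // ltnS [i <= q]leq_eqVlt (negbTE iq).
    by rewrite !H5 // eqxx andbF ltnn /= ltnSn qj.
  rewrite -[LHS]/(Cv (run row_body sg5) i) K1 !D5 eqxx andbF ltnS [i <= q]leq_eqVlt.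
  case: (eqVneq i q) => [->|//]; rewrite ltnn /=.
  case: (eqVneq q j) => [->|qj] /=; last by rewrite H5 // ltnn.
  by rewrite Qj // Qjj mul0r addr0.
split=> [i l iN lN|i iN].
  rewrite HQ // iN /= !Q4 // eqxx.
  by case: (eqVneq i j).
by rewrite HC iN /= !C4 !Q4 // eqxx; case: (eqVneq i j).
Qed.

Lemma run_elim sg : env sg ->
  let sg' := run elim_prog sg in
  (forall i l, i < N -> l < N -> Qv sg' i l = (elim_steps (Qv sg) (Cv sg) N).1 i l) /\
  (forall i, i < N -> Cv sg' i = (elim_steps (Qv sg) (Cv sg) N).2 i).
Proof.
move=> E /=; have n1 : nmem sg a_N 0 = N by exact: env_N E.
pose I q (sg' : memory R) :=
  (forall i l, i < N -> l < N -> Qv sg' i l = (elim_steps (Qv sg) (Cv sg) q).1 i l) /\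
  (forall i, i < N -> Cv sg' i = (elim_steps (Qv sg) (Cv sg) q).2 i).
suff: I N (run elim_prog sg) by [].
rewrite -{1}n1; apply: (@run_for_ind R I) => //.
move=> q sg2; rewrite n1 => qN [H2 D2] h51 fr frr.
have E2 : env sg2.
  by apply: (env_frame E); [move=> b hb; rewrite fr //; move: b hb; exact/allP|rewrite frr].
have [H3 D3] := run_elim_body E2 qN h51.
split=> [i l iN lN|i iN].
  rewrite -[LHS]/(Qv (run elim_body sg2) i l) H3 //= /elim_mx /pivot_row !H2 //.
rewrite -[LHS]/(Cv (run elim_body sg2) i) D3 //= /elim_rhs !H2 // !D2 //.
Qed.

End Evaluation.

(** * Recording values and enumerating the policies *)

Definition accept_body : lcmd :=
  LIf (RLe (RGet rQ (qidx (cell a_i0) (cell 55))) RZero) LSkip (setv 54 (NConst 0)).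

(** No real number stands for infinity, so the flag [a_has] tells whether [rBest] holds a value
    yet. *)
Definition record_prog : lcmd :=
  LIf (NLe (NConst 1) (cell a_has))
    (LIf (RLe (rcell rBest) (RGet rC (cell a_i0))) LSkip
       (setrv rBest (RGet rC (cell a_i0))))
    (seqs [:: setv a_has (NConst 1); setrv rBest (RGet rC (cell a_i0))]).

Definition accept_prog : lcmd :=
  seqs [:: setv 54 (NConst 1); LFor 55 a_N accept_body;
    LIf (NLe (NConst 1) (cell 54)) record_prog LSkip].

(* Adds 1 to the number whose base [n] digits are in [aPol]; 56 is the carry. *)
Definition odometer_body : lcmd :=
  LIf (NLe (NConst 1) (cell 56))
    (LIf (NLe (NAdd (NGet aPol (cell 57)) (NConst 2)) (cell a_n))
       (seqs [:: LN aPol (cell 57) (NAdd (NGet aPol (cell 57)) (NConst 1));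
          setv 56 (NConst 0)])
       (LN aPol (cell 57) (NConst 0)))
    LSkip.

Definition odometer_prog : lcmd :=
  seqs [:: setv 56 (NConst 1); LFor 57 a_N odometer_body].

Definition policy_body : lcmd :=
  seqs [:: clear_prog; build_prog; elim_prog; accept_prog; odometer_prog].

Definition copy_prog : lcmd :=
  seqs [:: setv a_n (NGet 0 (NConst 0)); setv a_m (NGet 0 (NConst 1));
    setv a_k (NGet 0 (NConst 2)); setv a_s (NGet 0 (NConst 3));
    setv a_y (NGet 0 (NConst 4))].

Definition code_body : lcmd :=
  seqs [:: LIf (NLe (NConst 1) (NGet aInit (cell 33)))
      (setv a_w0 (NAdd (cell a_w0) (cell a_K))) LSkip;
    twice a_K; setv 33 (NAdd (cell 33) (NConst 1))].

Definition pow_prog : lcmd :=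
  seqs [:: setv a_2m (NConst 1); LFor 30 a_m (twice a_2m);
    setv a_2k (NConst 1); LFor 30 a_k (twice a_2k);
    setv a_K (NConst 1); setv a_w0 (NConst 0); setv 33 (NConst 0);
    LFor 30 a_k (LFor 31 a_m code_body);
    setv a_H (cell a_K); LFor 30 a_m (halve a_H)].

Definition table_body : lcmd :=
  seqs [:: LN aVK (cell 30) (cell a_N); setv a_N (NAdd (cell a_N) (cell a_K))].

Definition table_prog : lcmd :=
  seqs [:: setv a_N (NConst 0); LFor 30 a_n table_body;
    setv a_i0 (NAdd (NGet aVK (cell a_s)) (cell a_w0))].

Definition rows_body : lcmd :=
  seqs [:: LN aRow (cell 30) (cell 32); setv 32 (NAdd (cell 32) (cell a_N));
    setv 33 (NConst 0); LFor 31 a_n (setv 33 (NAdd (cell 33) (cell a_P)));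
    setv a_P (cell 33)].

Definition rows_prog : lcmd :=
  seqs [:: setv a_P (NConst 1); setv 32 (NConst 0); LFor 30 a_N rows_body;
    setv a_has (NConst 0)].

Definition main_prog : lcmd := LFor 24 a_P policy_body.

Definition output_prog : lcmd :=
  seqs [:: LN 0 (NConst 0) (cell a_has); LR 0 (NConst 0) (rcell rBest)].

(* Without edges the answer is [+oo]; this case is treated apart because the
   allowed time is then only [n ^ n], with no room for a polynomial factor. *)
Definition best_policy_prog : cmd :=
  Seq (compile copy_prog)
    (If (NLe (cell a_m) (NConst 0)) (NSet 0 (NConst 0) (NConst 0))
      (Seq (compile pow_prog) (Seq (compile table_prog)
        (Seq (compile rows_prog) (Seq (compile main_prog) (compile output_prog)))))).

Definition digit (n r z : nat) : nat := (r %/ n ^ z) %% n.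

(** Existence of base [n] expansions: each policy shows up among the first [n ^ N] states of the
    odometer. *)
Lemma digit_sum (n N : nat) (f : nat -> nat) : (forall z, z < N -> f z < n) ->
  exists2 r, r < n ^ N & forall z, z < N -> digit n r z = f z.
Proof.
elim: N => [|N IH] H; first by exists 0; rewrite ?expn0.
have [|r rN Hr] := IH; first by move=> z zN; apply/H/ltnW.
have fN := H N (ltnSn N).
have n0 : 0 < n by exact: leq_ltn_trans fN.
exists (f N * n ^ N + r).
  rewrite expnS; apply: (@leq_trans ((f N).+1 * n ^ N)); first by rewrite mulSn addnC ltn_add2r.
  by rewrite leq_mul2r fN orbT.
move=> z; rewrite ltnS leq_eqVlt => /orP[/eqP ->|zN].
  by rewrite /digit divnMDl ?expn_gt0 ?n0 // divn_small // addn0 modn_small.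
rewrite -(Hr z zN) /digit.
have -> : n ^ N = n ^ (N - z.+1) * n * n ^ z by rewrite -mulnA -expnS -expnD subnK.
by rewrite !mulnA divnMDl ?expn_gt0 ?n0 // modnMDl.
Qed.

Section PolicyStep.
Variables (R : realType) (k n m : nat) (M : stgraph R k n m) (s y : 'I_n).
Hypothesis k_gt0 : 0 < k.
Let K := 2 ^ (k * m).
Let N := n * K.
Notation env := (env M s y).
Local Arguments Qv : simpl never.
Local Arguments Cv : simpl never.

Lemma n_gt0 : 0 < n.
Proof. exact: leq_ltn_trans (ltn_ord s). Qed.

Lemma run_odometer sg r : env sg ->
  (forall z, z < N -> nmem sg aPol z = digit n r z) ->
  forall z, z < N -> nmem (run odometer_prog sg) aPol z = digit n r.+1 z.
Proof.
move=> E H; rewrite /odometer_prog /seqs /foldr run_seq run_n run_seq run_skip.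
set sg1 := setn _ _ _ _.
have E1 : env sg1 by exact: env_setn.
have n1 : nmem sg1 a_N 0 = N by exact: env_N E1.
(* The increment carries into digit [q] exactly when all lower digits of [r.+1] vanish. *)
pose I q (sg' : memory R) := nmem sg' 56 0 = (n ^ q %| r.+1) /\
  forall z, z < N -> nmem sg' aPol z = if z < q then digit n r.+1 z else digit n r z.
suff [_ h] : I N (run (LFor 57 a_N odometer_body) sg1) by move=> z zN; rewrite h // zN.
rewrite -{1}n1; apply: (@run_for_ind R I) => //.
  by split=> [|z zN]; [rewrite /= expn0 dvd1n|exact: H].
move=> q sg2; rewrite n1 => qN [h56 H2] h57 fr frr.
have E2 : env sg2.
  by apply: (env_frame E1); [move=> b hb; rewrite fr //; move: b hb; exact/allP|rewrite frr].
have nq : 0 < n ^ q by rewrite expn_gt0 n_gt0.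
have P2 : nmem sg2 aPol q = digit n r q by rewrite H2 // ltnn.
rewrite /odometer_body run_if /= h56.
have dS : digit n r.+1 q = ((n ^ q %| r.+1) + r %/ n ^ q) %% n by rewrite /digit divnS.
have pS : (n ^ q.+1 %| r.+1) = (n ^ q %| r.+1) && (n %| (r %/ n ^ q).+1).
  case: (boolP (n ^ q %| r.+1)) => [d|d] /=.
    have e : (r %/ n ^ q).+1 = r.+1 %/ n ^ q by rewrite divnS // d.
    by rewrite e expnS dvdn_divRL // mulnC.
  by apply: contraNF d => /(dvdn_trans _); apply; rewrite expnS dvdn_mull.
case: (boolP (n ^ q %| r.+1)) => dq /=; last first.
  rewrite run_skip; split; first by rewrite /= h56 pS (negbTE dq).
  move=> z zN; rewrite /= H2 // ltnS [z <= q]leq_eqVlt.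
  case: (eqVneq z q) => [->|//]; by rewrite ltnn dS (negbTE dq).
rewrite dq in dS pS; rewrite add1n modnS in dS.
have ltP : (digit n r q + 2 <= n) = ~~ (n %| (r %/ n ^ q).+1).
  rewrite /digit; have lt := ltn_pmod (r %/ n ^ q) n_gt0.
  case: (boolP (n %| _)) => d.
    have : n %| ((r %/ n ^ q) %% n).+1 by rewrite -addn1 /dvdn modnDml addn1.
    by move=> /dvdn_leq -/(_ isT); lia.
  have := ltn_pmod (r %/ n ^ q).+1 n_gt0; rewrite modnS (negbTE d); lia.
rewrite run_if /= h57 P2 (env_n E2) ltP.
case: (boolP (n %| _)) dS pS => d /= dS pS.
  rewrite run_n /=; split; first by rewrite /= h56 dq pS.
  move=> z zN; rewrite /= h57; case: (eqVneq z q) => [->|zq]; first by rewrite ltnSn dS.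
  by rewrite H2 // ltnS [z <= q]leq_eqVlt (negbTE zq).
rewrite /seqs /foldr run_seq run_n run_seq run_n run_skip /=; split; first by rewrite /= pS.
move=> z zN; rewrite /= h57; case: (eqVneq z q) => [->|zq]; first by rewrite ltnSn dS P2 addn1.
by rewrite H2 // ltnS [z <= q]leq_eqVlt (negbTE zq).
Qed.

Lemma run_accept sg i0 : env sg -> i0 < N -> nmem sg a_i0 0 = i0 ->
  let ok := forall l, l < N -> (Qv k n m sg i0 l <= 0)%R in
  let sg' := run accept_prog sg in
  let has := nmem sg a_has 0 in let has' := nmem sg' a_has 0 in
  let best := rmem sg rBest 0 in let best' := rmem sg' rBest 0 in
  [/\ ok -> 0 < has' /\ (best' <= Cv sg i0)%R,
     0 < has -> 0 < has' /\ (best' <= best)%R &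
     0 < has' -> (ok /\ best' = Cv sg i0) \/ (0 < has /\ best' = best)].
Proof.
move=> E i0N hi0 ok /=; rewrite /accept_prog /seqs /foldr run_seq run_n run_seq run_seq run_skip.
set sg1 := setn _ _ _ _.
have E1 : env sg1 by exact: env_setn.
have n1 : nmem sg1 a_N 0 = N by exact: env_N E1.
pose I q (sg' : memory R) := nmem sg' 54 0 = 1 /\ (forall l, l < q -> (Qv k n m sg i0 l <= 0)%R) \/
  nmem sg' 54 0 = 0 /\ ~ (forall l, l < q -> (Qv k n m sg i0 l <= 0)%R).
have H : I N (run (LFor 55 a_N accept_body) sg1).
  rewrite -{1}n1; apply: (@run_for_ind R I) => //; first by left.
  move=> q sg2; rewrite n1 => qN H2 h55 fr frr.
  have E2 : env sg2.
    by apply: (env_frame E1); [move=> b hb; rewrite fr //; move: b hb; exact/allP|rewrite frr].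
  rewrite /accept_body run_if.
  have -> : teval sg2 (RLe (RGet rQ (qidx (cell a_i0) (cell 55))) RZero) =
      (Qv k n m sg i0 q <= 0)%R.
    rewrite -[LHS]/(rmem sg2 rQ (neval sg2 (qidx (cell a_i0) (cell 55))) <= 0)%R.
    have hi2 : neval sg2 (cell a_i0) = i0 by rewrite /= fr.
    by rewrite (env_qidx _ E2) ?hi2 // [neval _ (cell 55)]h55 frr //.
  case: ifP => le; [rewrite run_skip|rewrite run_n]; last first.
    by right; split=> // H; move: (H q (ltnSn q)); rewrite le.
  case: H2 => -[h54 H2]; [left|right]; split=> //.
    by move=> l; rewrite ltnS leq_eqVlt => /orP[/eqP ->|/H2].
  by move=> H; apply: H2 => l lq; apply: H; exact: ltnW.
have f1 := @run_nframe R (LFor 55 a_N accept_body) sg1.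
have f2 := @run_rframe R (LFor 55 a_N accept_body) sg1.
set sg2 := run _ sg1 in H f1 f2 *; clearbody sg2.
have h22 : nmem sg2 a_i0 0 = i0 by rewrite f1.
have h23 : nmem sg2 a_has 0 = nmem sg a_has 0 by rewrite f1.
have hB : rmem sg2 rBest = rmem sg rBest by rewrite f2.
have hC : rmem sg2 rC = rmem sg rC by rewrite f2.
rewrite run_if /=.
case: H => -[h54 H]; rewrite h54 /=; last first.
  by rewrite run_skip ?h23 hB; split=> // h; right.
rewrite /record_prog run_if /= h23.
case: (boolP (0 < nmem sg a_has 0)) => has0.
  rewrite run_if /= h22 hB hC -/(Cv sg i0).
  case: (boolP (rmem sg rBest 0 <= Cv sg i0)%R) => le.
    by rewrite run_skip ?h23 hB; split=> // _; right.
  rewrite run_r /= ?h23 h22 hC; split=> // _; last by left.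
  by split=> //; apply/ltW; rewrite ltNge.
rewrite /seqs /foldr run_seq run_n run_seq run_r run_skip /= h22 hC.
by split=> // _; left.
Qed.

Definition system_of f (Q : nat -> nat -> R) (c : nat -> R) :=
  positive_system N Q c /\
  forall (x : nat -> R) (v : 'I_n) w, w < K ->
    (c (v * K + w)%N + \sum_(l < N) Q (v * K + w)%N l * x l =
     1 + \sum_(a < 2 ^ m) entry_at M y f x w a v)%R.

(** [Q] and [c] are the contents of memory before elimination. They are hidden because the main loop
    uses them only through [system_of]. *)
Lemma run_policy sg r i0 : env sg -> i0 < N -> nmem sg a_i0 0 = i0 ->
  (forall z, z < N -> nmem sg aPol z = digit n r z) ->
  let sg' := run policy_body sg in
  let has := nmem sg a_has 0 in let has' := nmem sg' a_has 0 in
  let best := rmem sg rBest 0 in let best' := rmem sg' rBest 0 in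
  [/\ env sg', nmem sg' a_i0 0 = i0,
     forall z, z < N -> nmem sg' aPol z = digit n r.+1 z &
  exists Q c, [/\ system_of (nmem sg aPol) Q c,
     solved N Q c i0 -> 0 < has' /\ (best' <= (elim_steps Q c N).2 i0)%R,
     0 < has -> 0 < has' /\ (best' <= best)%R &
     0 < has' -> (solved N Q c i0 /\ best' = (elim_steps Q c N).2 i0) \/
       (0 < has /\ best' = best)]].
Proof.
move=> E i0N hi0 hpol /=; rewrite /policy_body /seqs /foldr 5!run_seq run_skip.
set f := nmem sg aPol.
have flt z : z < N -> f z < n by move=> zN; rewrite /f hpol // ltn_pmod // n_gt0.
have [C1 Q1] := run_clear k_gt0 E.
have E1 : env (run clear_prog sg) by apply: env_run.
have f1 := @run_nframe R clear_prog sg; have g1 := @run_rframe R clear_prog sg.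
set sg1 := run clear_prog sg in C1 Q1 E1 f1 g1 *; clearbody sg1.
have nn1 : nonneg_mx k n m sg1 by move=> i l iN lN; rewrite Q1.
have pol1 : nmem sg1 aPol = f by rewrite f1.
have [nn2 H2] := @run_build R k n m M s y k_gt0 f flt sg1 E1 pol1 nn1.
have E2 : env (run build_prog sg1) by apply: env_run.
have f2 := @run_nframe R build_prog sg1; have g2 := @run_rframe R build_prog sg1.
set sg2 := run build_prog sg1 in H2 nn2 E2 f2 g2 *; clearbody sg2.
have [H3 D3] := @run_elim R k n m M s y sg2 E2.
have E3 : env (run elim_prog sg2) by apply: env_run.
have f3 := @run_nframe R elim_prog sg2; have g3 := @run_rframe R elim_prog sg2.
set sg3 := run elim_prog sg2 in H3 D3 E3 f3 g3 *; clearbody sg3.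
have i3 : nmem sg3 a_i0 0 = i0 by rewrite f3 // f2 // f1.
have [A1 A2 A3] := run_accept E3 i0N i3.
have E4 : env (run accept_prog sg3) by apply: env_run.
have f4 := @run_nframe R accept_prog sg3.
set sg4 := run accept_prog sg3 in A1 A2 A3 E4 f4 *; clearbody sg4.
have E5 : env (run odometer_prog sg4) by apply: env_run.
have hpol4 z : z < N -> nmem sg4 aPol z = digit n r z.
  by move=> zN; rewrite f4 // f3 // f2 // pol1 /f hpol.
have O := run_odometer E4 hpol4.
have f5 := @run_nframe R odometer_prog sg4; have g5 := @run_rframe R odometer_prog sg4.
set sg5 := run odometer_prog sg4 in E5 O f5 g5 *; clearbody sg5.
have c1 i : i < N -> Cv sg2 i = 1%R by move=> iN; rewrite /Cv g2 //; exact: C1.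
have sol : solved N (Qv k n m sg2) (Cv sg2) i0 <-> (forall l, l < N -> (Qv k n m sg3 i0 l <= 0)%R).
  split=> h l lN; first by rewrite (H3 i0 l i0N lN); exact: h.
  by rewrite -(H3 i0 l i0N lN); exact: h.
have h3 : nmem sg3 a_has 0 = nmem sg a_has 0 by rewrite f3 // f2 // f1.
have b3 : rmem sg3 rBest 0 = rmem sg rBest 0 by rewrite g3 // g2 // g1.
have h5 : nmem sg5 a_has 0 = nmem sg4 a_has 0 by rewrite f5.
have b5 : rmem sg5 rBest 0 = rmem sg4 rBest 0 by rewrite g5.
rewrite h3 b3 in A2 A3.
split=> //; first by rewrite f5 // f4.
exists (Qv k n m sg2), (Cv sg2); rewrite -(D3 i0 i0N) h5 b5; split=> //.
- split=> [i iN|x v w wK]; first by split=> [|l lN]; [rewrite c1|exact: nn2].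
  rewrite c1 ?state_lt //; congr (1 + _)%R.
  rewrite -[LHS]/(rowsum k n m sg2 x (v * K + w)) H2 // [X in (X + _)%R]big1 ?add0r // => l _.
  by rewrite Q1 ?mul0r ?state_lt.
- by move=> /sol; exact: A1.
- by move=> /A3 [[/sol ? ?]|?]; [left|right].
Qed.

End PolicyStep.

(** * Set-up, main loop and running time *)

Section Setup.
Variables (R : realType) (k n m : nat) (M : stgraph R k n m) (s y : 'I_n).
Implicit Types (sg : memory R).
Hypothesis k_gt0 : 0 < k.
Let K := 2 ^ (k * m).
Let N := n * K.
Let g := nmem (input M s y) aInit.

(** During the scan of the initial window [a_K] is the weight of the next bit; it ends as
    [2 ^ (k * m)]. *)
Definition code_state b (sg : memory R) := [/\ nmem sg 33 0 = b, nmem sg a_K 0 = 2 ^ b &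
  nmem sg a_w0 0 = \sum_(0 <= b' < b) (0 < g b') * 2 ^ b'].

Lemma run_code_body b sg : nmem sg aInit = g -> code_state b sg ->
  code_state b.+1 (run code_body sg).
Proof.
move=> hg [h33 hK hw]; rewrite /code_body /seqs /foldr run_seq run_if.
set sg1 := (if _ then _ else _).
have [g33 gK gw] : [/\ nmem sg1 33 0 = b, nmem sg1 a_K 0 = 2 ^ b &
    nmem sg1 a_w0 0 = \sum_(0 <= b' < b.+1) (0 < g b') * 2 ^ b'].
  rewrite big_nat_recr //= -hw /sg1 /= h33 hg.
  by case: ifP => _; rewrite !runE /= ?h33 ?hK ?mul1n ?mul0n ?addn0.
clearbody sg1; rewrite !runE; split; rewrite /= ?g33 ?addn1 //.
by rewrite gK expnS mul2n addnn.
Qed.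

Lemma run_code sg : nmem sg a_m 0 = m -> nmem sg a_k 0 = k -> nmem sg aInit = g ->
  code_state 0 sg -> code_state (k * m) (run (LFor 30 a_k (LFor 31 a_m code_body)) sg).
Proof.
move=> hm hk hg h0.
pose I i sg' := code_state (i * m) sg'.
suff: I k (run (LFor 30 a_k (LFor 31 a_m code_body)) sg) by [].
rewrite -{1}hk; apply: (@run_for_ind R I) => //.
move=> i sg1; rewrite hk => ik H1 h30 fr frr.
have hm1 : nmem sg1 a_m 0 = m by rewrite fr.
pose J e sg' := code_state (i * m + e) sg'.
suff H : J m (run (LFor 31 a_m code_body) sg1) by rewrite /I mulSn addnC.
rewrite -{1}hm1; apply: (@run_for_ind R J) => //.
  by rewrite /J addn0.
move=> e sg2 _ H2 _ fr2 _; rewrite /J addnS.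
have hg2 : nmem sg2 aInit = g by rewrite fr2 // fr.
exact: run_code_body hg2 H2.
Qed.

Lemma dec_init w : w = \sum_(0 <= b < k * m) (0 < g b) * 2 ^ b ->
  dec_window k m w = init M.
Proof.
rewrite big_mkord => ->; apply: eq_from_tnth => i; apply/setP => e.
rewrite dec_snap_window.
have bkm : i * m + e < k * m by have := ltn_ord i; have := ltn_ord e; nia.
have := @bit_sum (fun b => 0 < g b) 0 _ _ bkm; rewrite mul0n add0n => ->.
by rewrite /g input_init; case: (_ \in _).
Qed.

Lemma run_pow sg : nmem sg a_m 0 = m -> nmem sg a_k 0 = k -> nmem sg aInit = g ->
  let sg' := run pow_prog sg in
  [/\ nmem sg' a_2m 0 = 2 ^ m, nmem sg' a_2k 0 = 2 ^ k, nmem sg' a_K 0 = K,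
      nmem sg' a_H 0 = 2 ^ ((k - 1) * m) &
      nmem sg' a_w0 0 = \sum_(0 <= b < k * m) (0 < g b) * 2 ^ b].
Proof.
move=> hm hk hg /=; rewrite /pow_prog /seqs /foldr.
rewrite run_seq run_n run_seq.
set sg1 := run (LFor _ _ _) _.
have [m1 k1 g1] : [/\ nmem sg1 a_m 0 = m, nmem sg1 a_k 0 = k & nmem sg1 aInit = g].
  by rewrite !run_nframe.
have A1 : nmem sg1 a_2m 0 = 2 ^ m by rewrite run_twice_loop //= hm mul1n.
clearbody sg1; rewrite run_seq run_n run_seq.
set sg2 := run (LFor _ _ _) _.
have [m2 k2 g2] : [/\ nmem sg2 a_m 0 = m, nmem sg2 a_k 0 = k & nmem sg2 aInit = g].
  by rewrite !run_nframe.
have A2 : nmem sg2 a_2m 0 = 2 ^ m by rewrite run_nframe.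
have B2 : nmem sg2 a_2k 0 = 2 ^ k by rewrite run_twice_loop //= k1 mul1n.
clearbody sg2; rewrite run_seq run_n run_seq run_n run_seq run_n run_seq.
set sg3 := setn _ _ _ _.
have [h33 hK hw] : code_state (k * m) (run (LFor 30 a_k (LFor 31 a_m code_body)) sg3).
  by apply: run_code => //; split; rewrite //= big_nil.
have f3 := @run_nframe R (LFor 30 a_k (LFor 31 a_m code_body)) sg3.
set sg4 := run _ sg3 in h33 hK hw f3 *; clearbody sg4.
rewrite run_seq run_n run_seq run_skip; split.
- by rewrite run_nframe //= f3.
- by rewrite run_nframe //= f3.
- by rewrite run_nframe.
- rewrite run_halve_loop //= hK f3 //= m2.
  have -> : k * m = (k - 1) * m + m by nia.
  by rewrite expnD mulnK // expn_gt0.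
- by rewrite run_nframe.
Qed.

Lemma run_table sg w0 : nmem sg a_n 0 = n -> nmem sg a_K 0 = K -> nmem sg a_s 0 = s ->
  nmem sg a_w0 0 = w0 ->
  let sg' := run table_prog sg in
  [/\ nmem sg' a_N 0 = N, forall v, v < n -> nmem sg' aVK v = v * K &
      nmem sg' a_i0 0 = s * K + w0].
Proof.
move=> hn hK hs hw sg'; rewrite {}/sg' /table_prog /seqs /foldr run_seq run_n run_seq.
set sg1 := setn _ _ _ _.
have n1 : nmem sg1 a_n 0 = n by [].
pose I q (sg' : memory R) := nmem sg' a_N 0 = q * K /\
  forall v, v < q -> nmem sg' aVK v = v * K.
have [HN HV] : I n (run (LFor 30 a_n table_body) sg1).
  rewrite -{1}n1; apply: (@run_for_ind R I) => //.
  move=> q sg2 _ [H2 V2] h30 fr _; rewrite /table_body /seqs /foldr !runE.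
  have hK2 : nmem sg2 a_K 0 = K by rewrite fr //; exact: hK.
  split=> [|v]; first by rewrite /= H2 hK2 mulSn addnC.
  rewrite ltnS leq_eqVlt /= h30 H2 => /orP[/eqP ->|vq]; first by rewrite eqxx.
  by rewrite ltn_eqF // V2.
have f1 := @run_nframe R (LFor 30 a_n table_body) sg1.
set sg2 := run _ sg1 in HN HV f1 *; clearbody sg2.
have s2 : nmem sg2 a_s 0 = s by rewrite f1 //; exact: hs.
have w2 : nmem sg2 a_w0 0 = w0 by rewrite f1 //; exact: hw.
by rewrite !runE /=; split=> //; rewrite s2 w2 HV.
Qed.

(** Naturals cannot be multiplied, so [n ^ N] takes [N] rounds of [n] additions each. *)
Lemma run_rows sg : nmem sg a_n 0 = n -> nmem sg a_N 0 = N ->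
  let sg' := run rows_prog sg in
  [/\ nmem sg' a_P 0 = n ^ N, forall i, i < N -> nmem sg' aRow i = i * N &
      nmem sg' a_has 0 = 0].
Proof.
move=> hn hN sg'; rewrite {}/sg' /rows_prog /seqs /foldr run_seq run_n run_seq run_n run_seq.
set sg1 := setn _ _ _ _.
have n1 : nmem sg1 a_N 0 = N by [].
pose I q (sg' : memory R) := [/\ nmem sg' a_P 0 = n ^ q, nmem sg' 32 0 = q * N &
  forall i, i < q -> nmem sg' aRow i = i * N].
have [HP _ HR] : I N (run (LFor 30 a_N rows_body) sg1).
  rewrite -{1}n1; apply: (@run_for_ind R I) => //.
  move=> q sg2 _ [P2 T2 R2] h30 fr _; rewrite /rows_body /seqs /foldr.
  rewrite run_seq run_n run_seq run_n run_seq run_n run_seq.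
  set sg3 := setn (setn (setn sg2 _ _ _) _ _ _) _ _ _.
  have n2 : nmem sg2 a_n 0 = n by rewrite fr //; exact: hn.
  have N2 : nmem sg2 a_N 0 = N by rewrite fr.
  have n3 : nmem sg3 a_n 0 = n by exact: n2.
  have h33 : nmem (run (LFor 31 a_n (setv 33 (NAdd (cell 33) (cell a_P)))) sg3) 33 0 = n * n ^ q.
    rewrite -{1}n3; apply: (@run_for_ind R (fun j sg' => nmem sg' 33 0 = j * n ^ q)) => //.
    by move=> j sg4 _ h _ fr4 _; rewrite run_n /= h fr4 //= P2 mulSn addnC.
  have f3 := @run_nframe R (LFor 31 a_n (setv 33 (NAdd (cell 33) (cell a_P)))) sg3.
  set sg4 := run _ sg3 in h33 f3 *; clearbody sg4.
  rewrite !runE; split; first by rewrite /= h33 expnS.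
    by rewrite /= f3 //= T2 N2 mulSn addnC.
  move=> i; rewrite ltnS leq_eqVlt /= f3 //= h30 T2 => /orP[/eqP ->|iq]; first by rewrite eqxx.
  by rewrite ltn_eqF // R2.
by rewrite !runE /=.
Qed.

Definition after_setup (sg : memory R) := [/\ env M s y sg,
  exists w0, [/\ w0 < K, dec_window k m w0 = init M & nmem sg a_i0 0 = s * K + w0],
  nmem sg a_P 0 = n ^ N, nmem sg a_has 0 = 0 & forall z, nmem sg aPol z = 0].

Lemma setup_correct :
  after_setup (run rows_prog (run table_prog (run pow_prog (run copy_prog (input M s y))))).
Proof.
set sg1 := run copy_prog _.
have [n1 m1 k1 s1 y1] : [/\ nmem sg1 a_n 0 = n, nmem sg1 a_m 0 = m, nmem sg1 a_k 0 = k,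
  nmem sg1 a_s 0 = s & nmem sg1 a_y 0 = y] by rewrite /sg1 /copy_prog /seqs /foldr !runE.
have i1 : nmem sg1 aInit = g by rewrite run_nframe.
have c1 a : a \notin nwrites copy_prog -> nmem sg1 a = nmem (input M s y) a.
  by move=> h; rewrite run_nframe.
have r1 : rmem sg1 rProb = rmem (input M s y) rProb by rewrite run_rframe.
have [A1 A2 A3 A4 A5] := run_pow m1 k1 i1.
have f2 := @run_nframe R pow_prog sg1; have g2 := @run_rframe R pow_prog sg1.
set sg2 := run pow_prog sg1 in A1 A2 A3 A4 A5 f2 g2 *; clearbody sg2.
set w0 := \sum_(0 <= b < k * m) (0 < g b) * 2 ^ b in A5.
have n2 : nmem sg2 a_n 0 = n by rewrite f2.
have s2 : nmem sg2 a_s 0 = s by rewrite f2.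
have [B1 B2 B3] := run_table n2 A3 s2 A5.
have f3 := @run_nframe R table_prog sg2; have g3 := @run_rframe R table_prog sg2.
set sg3 := run table_prog sg2 in B1 B2 B3 f3 g3 *; clearbody sg3.
have n3 : nmem sg3 a_n 0 = n by rewrite f3.
have [D1 D2 D3] := run_rows n3 B1.
have f4 := @run_nframe R rows_prog sg3; have g4 := @run_rframe R rows_prog sg3.
set sg4 := run rows_prog sg3 in D1 D2 D3 f4 g4 *; clearbody sg4.
split=> //.
- split; try by [rewrite f4 // f3 // f2 // c1 | rewrite g4 // g3 // g2].
  exact: D2.
- exists w0; split; [|exact: dec_init|by rewrite f4].
  by rewrite /w0 big_mkord; exact: (bit_sum_lt (fun b => 0 < g b)).
- by move=> z; rewrite f4 // f3 // f2 // c1.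
Qed.

End Setup.

(** * The recorded minimum is the optimal value *)

Section Correctness.
Variables (R : realType) (k n m : nat) (M : stgraph R k n m) (s y : 'I_n).
Implicit Types (sg : memory R).
Hypothesis k_gt0 : 0 < k.
Let K := 2 ^ (k * m).
Let N := n * K.

(** The default vertex [s] is reached only for indices beyond [N], which are not states. *)
Definition vec (T : Type) (f : window k m -> 'I_n -> T) (i : nat) : T :=
  f (dec_window k m (i %% K)) (insubd s (i %/ K)).

Lemma vecE (T : Type) (f : window k m -> 'I_n -> T) (v : 'I_n) w : w < K ->
  vec f (v * K + w) = f (dec_window k m w) v.
Proof.
move=> wK; have K0 : 0 < K by rewrite expn_gt0.
rewrite /vec modnMDl modn_small // divnMDl // divn_small // addn0.
by congr (f _ _); apply: val_inj; rewrite insubdK // -topredE /=.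
Qed.

Lemma state_split i : i < N -> exists (v : 'I_n) w, w < K /\ i = v * K + w.
Proof.
move=> iN; have K0 : 0 < K by rewrite expn_gt0.
have vn : i %/ K < n by rewrite ltn_divLR.
by exists (Ordinal vn), (i %% K); rewrite ltn_mod -divn_eq.
Qed.

Definition chosen f w (v : 'I_n) (A : snapshot m) : 'I_n :=
  choice_at M f (next_code k m w (enc_snap A)) (enc_snap A) v.

Lemma chosen_ok f w v A : move_ok M A v (chosen f w v A).
Proof.
rewrite /chosen /choice_at enc_snapK; case: ifP => // _; exact: move_ok_refl.
Qed.

Lemma entry_sum f (h : window k m -> 'I_n -> R) w v : w < K ->
  (\sum_(a < 2 ^ m) entry_at M y f (vec h) w a v =
   \sum_A step_prob M (dec_window k m w) A *
     stopped y h (push (dec_window k m w) A) (chosen f w v A))%R.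
Proof.
move=> wK; rewrite (sum_codes m (fun a => entry_at M y f (vec h) w a v)).
apply: eq_bigr => A _; rewrite /entry_at -/(chosen f w v A) /stopped.
case: ifP => _; first by rewrite mulr0.
rewrite vecE; last exact: next_code_lt wK (enc_snap_lt A).
by rewrite dec_next_code // /prob_at enc_snapK.
Qed.

(** The greedy backup is a minimum, so a single vector is a sub-solution for all policies at
    once. *)
Lemma value_sub_system f Q c T : system_of M y f Q c ->
  sub_solution N Q c (vec (value M y T)).
Proof.
move=> [_ rows] i iN; have [v [w [wK ->]]] := state_split iN.
rewrite rows // entry_sum // vecE //; apply: value_sub_choice => // A.
exact: chosen_ok.
Qed.

Definition policy_code (u : window k m -> 'I_n -> 'I_n) (z : nat) : nat := vec u z.

Lemma chosen_policy_code f u w v A : allowed M u -> w < K ->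
  (forall z, z < N -> f z = policy_code u z) ->
  chosen f w v A = u (push (dec_window k m w) A) v.
Proof.
move=> au wK fu; have w'K := next_code_lt k_gt0 wK (enc_snap_lt A).
rewrite /chosen /choice_at fu ?state_lt // /policy_code vecE // dec_next_code // enc_snapK.
rewrite valKd; have := au (push (dec_window k m w) A) v; rewrite last_push // => ->.
by [].
Qed.

Definition finite_at (i : nat) : bool := vec (fun W v => `[< bounded_value M y W v >]) i.

(** Elimination needs a real vector that is non-negative everywhere. The 0 at infinite states does
    not affect the finite rows, whose coefficients there vanish. *)
Definition finite_value W v : R :=
  if `[< bounded_value M y W v >] then limit_value M y W v else 0%R.

Lemma optimal_super_solution f Q c u : allowed M u ->
  (forall T0, exists2 T, T0 <= T &
    forall W v, value M y T.+1 W v = backup M y u (value M y T) W v) ->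
  (forall z, z < N -> f z = policy_code u z) ->
  system_of M y f Q c ->
  super_solution N finite_at Q c (vec finite_value).
Proof.
move=> au Hu fu [pos rows] i iN Fi; have [v [w [wK iE]]] := state_split iN.
have bv : bounded_value M y (dec_window k m w) v.
  by move: Fi; rewrite /finite_at iE vecE // => /asboolP.
have [b1 b2] := recurrent_bounded k_gt0 Hu bv.
have ch A := chosen_policy_code v A au wK fu.
split.
  have fv : finite_value (dec_window k m w) v = limit_value M y (dec_window k m w) v.
    by rewrite /finite_value asboolT.
  rewrite iE rows // entry_sum // vecE // fv.
  apply: le_trans b2; rewrite lerD2l ler_sum // => A _; rewrite ch.
  have [->|pA] := eqVneq (step_prob M (dec_window k m w) A) 0%R; first by rewrite !mul0r.
  rewrite /stopped; case: (eqVneq (u _ v) y) => [//|uA].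
  by rewrite /finite_value asboolT //; exact: b1.
move=> l lN Fl.
(* Rows are known only through their sums, so the row is tested on the indicator of the infinite
   states. By [b1] none of them contributes; the zero vector isolates the constant term, and
   non-negativity separates the coefficients. *)
pose h W v' : R := ((~~ `[< bounded_value M y W v' >])%:R)%R.
have r1 := rows (vec h) v w wK.
have r0 := rows (vec (fun _ _ => 0%R)) v w wK.
rewrite entry_sum // [X in _ = (_ + X)%R]big1 in r1; last first.
  move=> A _; rewrite ch.
  have [->|pA] := eqVneq (step_prob M (dec_window k m w) A) 0%R; first by rewrite !mul0r.
  rewrite /stopped; case: (eqVneq (u _ v) y) => [|uA]; first by rewrite mulr0.
  by rewrite /h asboolT ?mulr0 //; exact: b1.
rewrite entry_sum // [X in _ = (_ + X)%R]big1 in r0; last first.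
  by move=> A _; rewrite /stopped if_same mulr0.
rewrite [X in (_ + X)%R = _]big1 in r0; last by move=> l' _; rewrite /vec mulr0.
have s0 : (\sum_(l' < N) Q (v * K + w)%N l' * vec h l' = 0)%R.
  by apply: (addrI (c (v * K + w))); rewrite r1 r0.
have nn (l' : 'I_N) : true -> (0 <= Q (v * K + w)%N l' * vec h l')%R.
  move=> _; rewrite mulr_ge0 ?ler0n //; have [_ Qi] := pos i iN.
  by rewrite -iE Qi.
have z := psumr_eq0P nn s0; have := z (Ordinal lN) isT; rewrite /= -iE.
by move: Fl; rewrite /finite_at /vec /h => ->; rewrite mulr1.
Qed.

(** The last two clauses bound the record from both sides: it is never below [V], and every policy
    already met that admits a super-solution finite at [i0] bounds it above. The system is
    quantified because elimination overwrites it. *)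
Definition outcome i0 q (sg : memory R) := [/\ env M s y sg, nmem sg a_i0 0 = i0,
  forall z, z < N -> nmem sg aPol z = digit n q z,
  0 < nmem sg a_has 0 -> forall T, (vec (value M y T) i0 <= rmem sg rBest 0)%R &
  forall r (F : nat -> bool) (x : nat -> R), r < q -> (forall i, 0 <= x i)%R -> F i0 ->
    (forall f Q c, (forall z, z < N -> f z = digit n r z) -> system_of M y f Q c ->
       super_solution N F Q c x) ->
    0 < nmem sg a_has 0 /\ (rmem sg rBest 0 <= x i0)%R].

Lemma main_correct sg i0 : i0 < N -> outcome i0 0 sg ->
  outcome i0 (nmem sg a_P 0) (run main_prog sg).
Proof.
move=> i0N H0; apply: (@run_for_ind R (outcome i0)) => //.
  by case: H0 => E *; split=> //; exact: env_setn.
move=> q sg1 _ [E1 hi hpol snd cmp] _ fr frr.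
have [E2 hi2 hpol2 [Q [c [sys A1 A2 A3]]]] := run_policy k_gt0 E1 i0N hi hpol.
set sg2 := run policy_body sg1 in E2 hi2 hpol2 A1 A2 A3 *; clearbody sg2.
have [pos _] := sys.
split=> //.
- exact: env_setn.
- move=> /A3 [[sv ->] T|[h ->]]; last exact: snd.
  by apply: (solved_sub pos) => //; exact: value_sub_system sys.
- move=> r F x; rewrite ltnS leq_eqVlt => /orP[/eqP ->|rq] x0 Fi H.
    have [sv le] := solved_super pos i0N Fi x0 (H _ _ _ hpol sys).
    have [h1 h2] := A1 sv; split=> //; exact: le_trans h2 le.
  have [h1 h2] := cmp r F x rq x0 Fi H.
  by have [h3 h4] := A2 h1; split=> //; exact: le_trans h4 h2.
Qed.

Lemma final_value sg : after_setup M s y sg ->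
  let sg' := run main_prog sg in
  if nmem sg' a_has 0 == 0 then forall b, exists T, (b < value M y T (init M) s)%R
  else (forall T, value M y T (init M) s <= rmem sg' rBest 0)%R /\
    (forall b, (forall T, value M y T (init M) s <= b) -> rmem sg' rBest 0 <= b)%R.
Proof.
move=> [E [w0 [w0K dw0 hi0]] hP hhas hpol] /=.
have i0N : s * K + w0 < N by exact: state_lt.
have [|_ _ _ snd cmp] := @main_correct sg (s * K + w0) i0N.
  by split=> //; [move=> z zN; rewrite hpol /digit div0n mod0n|rewrite hhas].
set sg' := run main_prog sg in snd cmp *; clearbody sg'.
have bnd : bounded_value M y (init M) s ->
    0 < nmem sg' a_has 0 /\ (rmem sg' rBest 0 <= limit_value M y (init M) s)%R.
  move=> bi; have [u au Hu] := recurrent_greedy M y.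
  have pn z : z < N -> policy_code u z < n by move=> _; exact: ltn_ord.
  (* [r] is the round in which the odometer shows the optimal policy [u]. *)
  have [r rN dr] := digit_sum pn.
  have := cmp r finite_at (vec finite_value); rewrite hP => /(_ rN).
  rewrite /finite_at !vecE // dw0 /finite_value asboolT //; apply=> //.
    move=> i; rewrite /vec; case: asboolP => // b; exact: limit_value_ge0.
  move=> f Q c fd; apply: optimal_super_solution au Hu _ => z zN.
  by rewrite fd // dr.
have val T : vec (value M y T) (s * K + w0) = value M y T (init M) s.
  by rewrite vecE // dw0.
case: (posnP (nmem sg' a_has 0)) => [h0 b|hpos].
  have [//|nb] := pselect (exists T, (b < value M y T (init M) s)%R).
  have : bounded_value M y (init M) s.
    exists b => T; rewrite leNgt; apply/negP => h; apply: nb; by exists T.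
  by move=> /bnd []; rewrite h0.
have snd' T : (value M y T (init M) s <= rmem sg' rBest 0)%R by rewrite -val snd.
split=> // b hb.
have [|_ h] := bnd; first by exists b.
apply: le_trans h _; exact: limit_value_le.
Qed.

End Correctness.

(** * Running time *)

Lemma exec_run_bounded (R : realType) (sg : memory R) c B (bs : seq nat) :
  wf c -> all (fun b => b \in bs) (lbounds c) ->
  all (fun b => b \notin nwrites c) (lbounds c) ->
  all (fun b => nmem sg b 0 <= B) bs ->
  exists2 t, t <= tmax B c & exec (compile c) sg t (run c sg).
Proof.
move=> w /allP h1 /allP h2 /allP h3; apply: exec_run => // b hb.
by split; [exact/h3/h1|exact: h2].
Qed.

(** The [D]-th power of [N <= D * 2 ^ (N %/ D)], which follows from [q.+1 <= 2 ^ q]. *)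
Lemma expn_le_exp2 D N : 0 < D -> N ^ D <= D ^ D * 2 ^ N.
Proof.
move=> D0; have h : N <= D * 2 ^ (N %/ D).
  apply: ltnW; rewrite {1}(divn_eq N D); apply: (@leq_trans (D * (N %/ D).+1)).
    by rewrite mulnS mulnC addnC ltn_add2r ltn_mod.
  by rewrite leq_mul2l ltn_expl ?orbT.
apply: (@leq_trans ((D * 2 ^ (N %/ D)) ^ D)); first by rewrite leq_exp2r.
by rewrite expnMn -expnM leq_mul2l leq_pexp2l ?orbT // leq_trunc_div.
Qed.

Definition time_depth : nat := depth policy_body.

(** The summand 100 absorbs the test for edges and the overhead of the outer loop, which is 4 + 10 +
    13 [n ^ N]. *)
Definition time_const : nat :=
  tmax 1 copy_prog + tmax 1 pow_prog + tmax 1 table_prog + tmax 1 rows_prog +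
  tmax 1 policy_body + tmax 1 output_prog + 100.

Lemma tmax_le c N : 0 < N -> depth c <= time_depth ->
  tmax N c <= tmax 1 c * N ^ time_depth.
Proof.
move=> N0 dc; apply: leq_trans (tmax_poly c N0) _.
by rewrite leq_mul2l leq_pexp2l // orbT.
Qed.

Section Timing.
Variables (R : realType) (k n m : nat) (M : stgraph R k n m) (s y : 'I_n).
Hypothesis k_gt0 : 0 < k.
Hypothesis m_gt0 : 0 < m.
Let K := 2 ^ (k * m).
Let N := n * K.

Lemma program_halts : exists T, T <= time_const * (N ^ time_depth * n ^ N) /\
  exec best_policy_prog (input M s y) T
    (run output_prog (run main_prog (run rows_prog (run table_prog
       (run pow_prog (run copy_prog (input M s y))))))).
Proof.
have n0 : 0 < n by exact: leq_ltn_trans (ltn_ord s).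
have K0 : 0 < K by rewrite expn_gt0.
have nN : n <= N by rewrite leq_pmulr.
have KN : K <= N by rewrite leq_pmull.
have N0 : 0 < N by exact: leq_trans nN.
(* An edge is needed here: with [m = 0] one has [K = 1], and [k] is not bounded by it. *)
have kK : k <= K.
  by apply: leq_trans (ltnW (ltn_expl k (ltnSn 1))) _; rewrite leq_pexp2l // leq_pmulr.
have m2K : 2 ^ m <= K by rewrite leq_pexp2l // leq_pmull.
have mK : m <= K by apply: leq_trans (ltnW (ltn_expl m (ltnSn 1))) m2K.
have kN := leq_trans kK KN; have mN := leq_trans mK KN; have m2N := leq_trans m2K KN.
have [t1 le1 e1] : exists2 t, t <= tmax N copy_prog &
    exec (compile copy_prog) (input M s y) t (run copy_prog (input M s y)).
  exact: (@exec_run_bounded R _ _ _ [::]).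
have S := setup_correct M s y k_gt0.
set sg1 := run copy_prog _ in e1 S *.
have [n1 m1 k1 s1] : [/\ nmem sg1 a_n 0 = n, nmem sg1 a_m 0 = m, nmem sg1 a_k 0 = k &
  nmem sg1 a_s 0 = s] by rewrite /sg1 /copy_prog /seqs /foldr !runE.
have i1 : nmem sg1 aInit = nmem (input M s y) aInit by rewrite run_nframe.
clearbody sg1.
have [t2 le2 e2] : exists2 t, t <= tmax N pow_prog &
    exec (compile pow_prog) sg1 t (run pow_prog sg1).
  by apply: (@exec_run_bounded R _ _ _ [:: a_m; a_k]) => //=; rewrite m1 k1 mN kN.
have [A1 A2 A3 A4 A5] := run_pow k_gt0 m1 k1 i1.
have f2 := @run_nframe R pow_prog sg1.
set sg2 := run pow_prog sg1 in A1 A2 A3 A4 A5 f2 e2 S *; clearbody sg2.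
have [n2 s2] : nmem sg2 a_n 0 = n /\ nmem sg2 a_s 0 = s by rewrite !f2.
have [t3 le3 e3] : exists2 t, t <= tmax N table_prog &
    exec (compile table_prog) sg2 t (run table_prog sg2).
  by apply: (@exec_run_bounded R _ _ _ [:: a_n]) => //=; rewrite n2 nN.
have [B1 B2 B3] := run_table n2 A3 s2 A5.
have f3 := @run_nframe R table_prog sg2.
set sg3 := run table_prog sg2 in B1 B2 B3 f3 e3 S *; clearbody sg3.
have n3 : nmem sg3 a_n 0 = n by rewrite f3.
have [t4 le4 e4] : exists2 t, t <= tmax N rows_prog &
    exec (compile rows_prog) sg3 t (run rows_prog sg3).
  by apply: (@exec_run_bounded R _ _ _ [:: a_n; a_N]) => //=; rewrite n3 B1 nN /= leqnn.
set sg4 := run rows_prog sg3 in e4 S *; clearbody sg4.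
have [E _ hP _ _] := S.
have [t5 le5 e5] : exists2 t, t <= 10 + nmem sg4 a_P 0 * (13 + tmax N policy_body) &
    exec (compile main_prog) sg4 t (run main_prog sg4).
  apply: exec_for => // sg' fr.
  apply: (@exec_run_bounded R _ _ _ [:: a_n; a_m; a_k; a_K; a_N; a_2m]) => //.
  rewrite /= !fr // (env_n E) (env_m E) (env_k E) (env_K E) (env_N E) (env_2m E).
  by rewrite nN mN kN KN m2N leqnn.
set sg5 := run main_prog sg4 in e5 *.
have [t6 le6 e6] : exists2 t, t <= tmax N output_prog &
    exec (compile output_prog) sg5 t (run output_prog sg5).
  exact: (@exec_run_bounded R _ _ _ [::]).
exists (t1 + (4 + (t2 + (t3 + (t4 + (t5 + t6)))))); split; last first.
  apply: ExecSeq e1 _; apply: (@ExecIfFalse R (NLe (cell a_m) (NConst 0))).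
    by rewrite /= m1 -ltnNge.
  by do 4![apply: ExecSeq; [eassumption|]]; exact: e6.
have P0 : 0 < n ^ N by rewrite expn_gt0 n0.
have D0 : 0 < N ^ time_depth by rewrite expn_gt0 N0.
move: le1 le2 le3 le4 le5 le6; rewrite hP.
have := tmax_le (c := copy_prog) N0 isT; have := tmax_le (c := pow_prog) N0 isT.
have := tmax_le (c := table_prog) N0 isT; have := tmax_le (c := rows_prog) N0 isT.
have := tmax_le (c := policy_body) N0 isT; have := tmax_le (c := output_prog) N0 isT.
rewrite /time_const.
set a1 := tmax 1 copy_prog; set a2 := tmax 1 pow_prog; set a3 := tmax 1 table_prog.
set a4 := tmax 1 rows_prog; set a5 := tmax 1 policy_body; set a6 := tmax 1 output_prog.
set D := N ^ time_depth in D0 *; set P := n ^ N in P0 *.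
move: (tmax N copy_prog) (tmax N pow_prog) (tmax N table_prog) (tmax N rows_prog) => b1 b2 b3 b4.
move: (tmax N policy_body) (tmax N output_prog) => b5 b6.
move=> h6 h5 h4 h3 h2 h1 l1 l2 l3 l4 l5 l6.
clearbody D P a1 a2 a3 a4 a5 a6.
have q a : a * D <= a * (D * P) by rewrite mulnA leq_pmulr.
have := q a1; have := q a2; have := q a3; have := q a4; have := q a6.
have : P * b5 <= a5 * (D * P) by rewrite [D * P]mulnC mulnCA leq_mul2l h5 orbT.
have : P <= D * P by rewrite leq_pmull.
move: l5; rewrite mulnDr !mulnDl; lia.
Qed.

End Timing.

Lemma time_bound (c D k n m : nat) : 0 < D -> 0 < k -> 0 < m -> 0 < n ->
  c * ((n * 2 ^ (k * m)) ^ D * n ^ (n * 2 ^ (k * m))) <=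
  c * D ^ D * (n * 2 ^ (k * m)) ^ (n * 2 ^ (k * m)).
Proof.
move=> D0 k0 m0 n0; rewrite -mulnA leq_mul2l; apply/orP; right.
have N0 : 0 < n * 2 ^ (k * m) by rewrite muln_gt0 n0 expn_gt0.
set N := n * 2 ^ (k * m) in N0 *.
have -> : N ^ N = (2 ^ (k * m)) ^ N * n ^ N by rewrite {1}/N expnMn mulnC.
rewrite mulnA leq_mul2r; apply/orP; right.
apply: leq_trans (expn_le_exp2 N D0) _; rewrite leq_mul2l leq_exp2r //.
by rewrite -{1}[2]expn1 leq_pexp2l ?orbT // muln_gt0 k0.
Qed.

(** With [N = n * 2 ^ (k * m)], log2 [N] is [k * m] + log2 [n]; the exponent of the theorem is
    therefore [N] log2 [N], and the allowed time is [N ^ N]. *)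
Lemma exponent_value (R : realType) (k n m : nat) : 0 < n ->
  (2 `^ (((k * m * n)%:R + n%:R * log2 (n%:R : R)) * 2 ^+ (k * m)) =
   ((n * 2 ^ (k * m)) ^ (n * 2 ^ (k * m)))%:R :> R)%R.
Proof.
move=> n0.
have N0 : (0 < (n * 2 ^ (k * m))%:R :> R)%R by rewrite ltr0n muln_gt0 n0 expn_gt0.
have l2 : (ln 2 != 0 :> R)%R by rewrite gt_eqF // ln_gt0 // ltr1n.
transitivity (expR ((n * 2 ^ (k * m))%:R * ln (n * 2 ^ (k * m))%:R : R))%R; last first.
  by rewrite expRM_natl lnK ?posrE // natrX.
rewrite /powR ifF; last by apply/negbTE; rewrite pnatr_eq0.
congr (expR _).
have -> : (ln (n * 2 ^ (k * m))%:R = ln n%:R + (k * m)%:R * ln 2 :> R)%R.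
  rewrite natrM lnM ?posrE ?ltr0n ?expn_gt0 //; congr (_ + _)%R.
  by rewrite natrX lnXn ?ltr0n // mulr_natl.
by rewrite /log2 !natrM natrX; field.
Qed.

Local Open Scope ring_scope.

Theorem theorem12 (R : realType) :
  exists (c : cmd) (C : R),
    forall (k n m : nat) (M : stgraph R k n m) (s y : 'I_n),
      (1 <= k)%N -> s != y ->
      exists (T : nat) (sg : memory R),
        [/\ exec c (input M s y) T sg,
            T%:R <= C * 2 `^ (((k * m * n)%:R + n%:R * log2 (n%:R : R))
                              * 2 ^+ (k * m))
          & forall (d : measure_display) (Omega : measurableType d)
                   (P : probability Omega R) (X : nat -> Omega -> {set 'I_m}),
              is_evolution M P X -> is_best M P X s y (output sg)].
Proof.
(* The factor [time_depth ^ time_depth] is the price of bounding the power of [N] by [2 ^ N]. *)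
exists best_policy_prog, ((time_const * time_depth ^ time_depth)%N%:R).
move=> k n m M s y k0 sy.
have n0 : (0 < n)%N by exact: leq_ltn_trans (ltn_ord s).
rewrite exponent_value //.
have [m0|m_gt0] := posnP m.
- pose sg := run copy_prog (input M s y).
  have m1 : nmem sg a_m 0%N = m by rewrite /sg /copy_prog /seqs /foldr !runE.
  have [t1 le1 e1] : exists2 t, (t <= tmax 1 copy_prog)%N &
      exec (compile copy_prog) (input M s y) t sg.
    exact: (@exec_run_bounded R _ _ _ [::]).
  clearbody sg; exists (t1 + (4 + 3))%N, (Memory (update (nmem sg) 0%N 0%N 0%N) (rmem sg)); split.
  + apply: ExecSeq e1 _; apply: (@ExecIfTrue R (NLe (cell a_m) (NConst 0))).
      by rewrite /= m1 m0.
    exact: (@ExecNSet R 0%N (NConst 0) (NConst 0)).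
  + rewrite -natrM ler_nat; apply: (@leq_trans (time_const * 1)).
      by rewrite muln1 /time_const; move: le1; lia.
    by rewrite -mulnA leq_mul2l muln_gt0 !expn_gt0 muln_gt0 n0 expn_gt0 orbT.
  + move=> d Omega P X ev; rewrite /output /= -/(0%N); apply: is_best_infinite => // b.
    (* Without edges the value at horizon [T] is [T] itself, so any natural number above [b]
       serves. *)
    exists (Num.bound `|b|); move: M sg m1 e1 X ev; rewrite {}m0 => M _ _ _ _ _.
    rewrite value_no_edges //; apply: le_lt_trans (ler_norm _) _; exact: archi_boundP.
- have [T [hT eT]] := program_halts M s y k0 m_gt0.
  exists T; eexists; split; first exact: eT.
    by rewrite -natrM ler_nat; apply: leq_trans hT _; exact: time_bound.
  move=> d Omega P X ev.
  have S := setup_correct M s y k0; have := final_value k0 S.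
  set sg := run main_prog _ => /=.
  have [h0 r0] : nmem (run output_prog sg) 0 0 = nmem sg a_has 0%N /\
      rmem (run output_prog sg) 0 0 = rmem sg rBest 0%N by rewrite /output_prog /seqs /foldr !runE.
  rewrite /output h0 r0; case: ifP => _.
    by move=> H; apply: is_best_infinite.
  by move=> [ub lub]; apply: is_best_finite.
Qed.
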